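(* Let $T\subset\mathbb{P}^3$ be a tetrahedron with faces $f_i$ ($0\le i\le3$) and edges $l_{ij}:=f_i\cap f_j$ for $0\le i<j\le3$. Let $v_i$ be the vertex opposite to the face $f_i$, for $0\le i\le3$. Let $\pi$ be a plane through the vertex $v_0$, which intersects the face $f_i$ along a line $r_i$, for $1\le i\le3$, and let us define the point $q_i:=r_i\cap l_{0i}$. Then the BS-EF 3-fold $W_{BS}^{10}$ can be obtained as the image of $\mathbb{P}^3$ via the rational map $\nu_{\mathcal{M}}:\mathbb{P}^3\dashrightarrow\mathbb{P}^{10}$ defined by the linear system $\mathcal{M}$ of the sextic surfaces of $\mathbb{P}^3$ which are quadruple at the vertex $v_0$, triple at the other three vertices $v_1,v_2,v_3$, and double along the three lines $r_1,r_2,r_3$. Furthermore, a general element of $\mathcal{M}$ also contains the six edges of $T$.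
   Context: We work over $\mathbb{C}$. The image of a rational map means the closure of the image of its domain of definition. $W_{BS}^{10}$ (the BS-EF 3-fold of genus $10$): let $S_6\subset\mathbb{P}^6_{[x_0:\dots:x_6]}$ be the smooth sextic Del Pezzo surface given by the image of $\mathbb{P}^2$ via $[u_0:u_1:u_2]\mapsto[u_1^2u_2:u_1u_2^2:u_0^2u_2:u_0u_2^2:u_0^2u_1:u_0u_1^2:u_0u_1u_2]$, and let $X=\mathbb{P}^1_{[y_0:y_1]}\times S_6$. Let $\sigma$ be the involution of $X$ given by $[y_0:y_1]\times[x_0:\dots:x_6]\mapsto[y_0:-y_1]\times[x_2:x_4:x_0:x_5:x_1:x_3:x_6]$, which has eight fixed points. Then $W_{BS}^{10}:=X/\sigma$, embedded in $\mathbb{P}^{10}$ by the quotient map with coordinates $y_0^2x_6$, $y_0^2(x_0+x_2)$, $y_0^2(x_1+x_4)$, $y_0^2(x_3+x_5)$, $y_1^2x_6$, $y_1^2(x_0+x_2)$, $y_1^2(x_1+x_4)$, $y_1^2(x_3+x_5)$, $y_0y_1(x_0-x_2)$, $y_0y_1(x_1-x_4)$, $y_0y_1(x_3-x_5)$. Embedded threefolds are considered up to projective transformations of $\mathbb{P}^{10}$.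
   Formalization: The three lines r_1, r_2, r_3 are assumed pairwise distinct, i.e. the plane π contains none of v_1, v_2, v_3; if π passes through v_3, say, then r_1 = r_2 is an edge, M has (vector space) dimension 24, and the map does not go to P^10. *)

(* Defs.v *)
From mathcomp Require Import all_boot all_order all_algebra.
From mathcomp Require Import reals.
From mathcomp Require Import complex.
From mathcomp Require Import mpoly.

Set Implicit Arguments.
Unset Strict Implicit.
Unset Printing Implicit Defensive.

Import GRing.Theory.
Local Open Scope ring_scope.

(* The points of P^(n-1) are the nonzero vectors of 'rV[K]_n up to scaling.   *)
(* A subset of P^(n-1) is a predicate on 'rV[K]_n which holds of nonzero      *)
(* vectors only and is invariant under nonzero scaling.  A linear subspace of *)
(* P^(n-1) is the row space of a matrix: points, lines and planes of P^3 have *)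
(* ranks 1, 2 and 3.                                                          *)

Section Projective.
Variable K : fieldType.

Definition proj_space (n : nat) : 'rV[K]_n -> Prop := fun x => x != 0.

Definition zclosure (n : nat) (Y : 'rV[K]_n -> Prop) : 'rV[K]_n -> Prop :=
  fun z => z != 0 /\
    forall (d : nat) (G : {mpoly K[n]}), G \is d.-homog ->
      (forall y, Y y -> G.@[y 0] = 0) -> G.@[z 0] = 0.

(* The points where phi vanishes contribute nothing, since w != 0. *)
Definition proj_image (T : Type) (n : nat) (D : T -> Prop)
    (phi : T -> 'rV[K]_n) : 'rV[K]_n -> Prop :=
  fun w => w != 0 /\ exists x a, D x /\ w = a *: phi x.

Definition rat_image (T : Type) (n : nat) (D : T -> Prop)
    (phi : T -> 'rV[K]_n) : 'rV[K]_n -> Prop :=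
  zclosure (proj_image D phi).

Definition proj_equiv (n : nat) (Y Z : 'rV[K]_n -> Prop) : Prop :=
  exists2 A : 'M[K]_n, A \in unitmx & forall w, Y w <-> Z (w *m A).

(* P holds for c in a nonempty Zariski open subset of K^n. *)
Definition generically (n : nat) (P : 'rV[K]_n -> Prop) : Prop :=
  exists2 G : {mpoly K[n]}, G != 0 & forall c : 'rV[K]_n, G.@[c 0] != 0 -> P c.

(* A form F has multiplicity >= m at [p] iff its partial derivatives of       *)
(* order < m vanish at p (in characteristic 0).                               *)
Definition mult_at_point (m : nat) (F : {mpoly K[4]}) (p : 'rV[K]_4) : Prop :=
  forall k : 'X_{1..4}, (mdeg k < m)%N -> (F^`M[k]).@[p 0] = 0.

Definition mult_along (m : nat) (F : {mpoly K[4]}) (L : 'M[K]_4) : Prop :=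
  forall p : 'rV[K]_4, p != 0 -> (p <= L)%MS -> mult_at_point m F p.

Definition contains (F : {mpoly K[4]}) (L : 'M[K]_4) : Prop :=
  forall p : 'rV[K]_4, (p <= L)%MS -> F.@[p 0] = 0.

Local Notation "v .[[ k ]]" := (v 0 (inord k))
  (at level 2, format "v .[[ k ]]").

Definition dp6_map (u : 'rV[K]_3) : 'rV[K]_7 :=
  let u0 := u.[[0]] in let u1 := u.[[1]] in let u2 := u.[[2]] in
  \row_(j < 7)
    [:: u1 ^+ 2 * u2; u1 * u2 ^+ 2; u0 ^+ 2 * u2; u0 * u2 ^+ 2;
        u0 ^+ 2 * u1; u0 * u1 ^+ 2; u0 * u1 * u2]`_j.

Definition dp6 : 'rV[K]_7 -> Prop := rat_image (@proj_space 3) dp6_map.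

Definition P1xdp6 (p : 'rV[K]_2 * 'rV[K]_7) : Prop :=
  proj_space p.1 /\ dp6 p.2.

Definition sigma (p : 'rV[K]_2 * 'rV[K]_7) : 'rV[K]_2 * 'rV[K]_7 :=
  let: (y, x) := p in
  (\row_(j < 2) [:: y.[[0]]; - y.[[1]]]`_j,
   \row_(j < 7) [:: x.[[2]]; x.[[4]]; x.[[0]]; x.[[5]];
                    x.[[1]]; x.[[3]]; x.[[6]]]`_j).

Definition quot_map (p : 'rV[K]_2 * 'rV[K]_7) : 'rV[K]_11 :=
  let: (y, x) := p in
  let y0 := y.[[0]] in let y1 := y.[[1]] in
  \row_(j < 11)
    [:: y0 ^+ 2 * x.[[6]];
        y0 ^+ 2 * (x.[[0]] + x.[[2]]);
        y0 ^+ 2 * (x.[[1]] + x.[[4]]);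
        y0 ^+ 2 * (x.[[3]] + x.[[5]]);
        y1 ^+ 2 * x.[[6]];
        y1 ^+ 2 * (x.[[0]] + x.[[2]]);
        y1 ^+ 2 * (x.[[1]] + x.[[4]]);
        y1 ^+ 2 * (x.[[3]] + x.[[5]]);
        y0 * y1 * (x.[[0]] - x.[[2]]);
        y0 * y1 * (x.[[1]] - x.[[4]]);
        y0 * y1 * (x.[[3]] - x.[[5]])]`_j.

Lemma quot_map_sigma p : quot_map (sigma p) = quot_map p.
Proof.
case: p => y x; apply/rowP => j; rewrite /quot_map /sigma !mxE !inordK //=.
congr (nth _ _ _); rewrite sqrrN !mulrN !mulNr -!mulrN !opprB.
by rewrite (addrC x.[[2]]) (addrC x.[[4]]) (addrC x.[[5]]).
Qed.

(* On P1xdp6, quot_map has no zeros and its fibres are the sigma-orbits, so   *)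
(* its image is the quotient by sigma embedded in P^10; being the image of a  *)
(* morphism from a projective variety, it needs no closure.                   *)
Definition W_BS10 : 'rV[K]_11 -> Prop := proj_image P1xdp6 quot_map.

(* f i is the plane containing the i-th face. *)
Definition is_tetrahedron (f : 'I_4 -> 'M[K]_4) : Prop :=
  (forall i, \rank (f i) = 3%N) /\ \rank (\bigcap_i f i)%MS = 0%N.

Definition edge (f : 'I_4 -> 'M[K]_4) (i j : 'I_4) : 'M[K]_4 :=
  (f i :&: f j)%MS.

(* The vertex opposite to a face lies on the other three faces. *)
Definition vertex (f : 'I_4 -> 'M[K]_4) (i : 'I_4) : 'M[K]_4 :=
  (\bigcap_(j | j != i) f j)%MS.

(* The vector space of forms defining M, including 0. *)
Definition linsysM (f r : 'I_4 -> 'M[K]_4) (F : {mpoly K[4]}) : Prop :=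
  [/\ F \is 6.-homog,
      mult_along 4 F (vertex f 0),
      forall i, i != 0 -> mult_along 3 F (vertex f i) &
      forall i, i != 0 -> mult_along 2 F (r i)].

Definition is_basis (n : nat) (M : {mpoly K[4]} -> Prop)
    (b : 'I_n -> {mpoly K[4]}) : Prop :=
  (forall c : 'rV[K]_n, M (\sum_j c 0 j *: b j)) /\
  (forall F, M F -> exists! c : 'rV[K]_n, F = \sum_j c 0 j *: b j).

Definition linsys_map (n : nat) (b : 'I_n -> {mpoly K[4]})
    (p : 'rV[K]_4) : 'rV[K]_n :=
  \row_j (b j).@[p 0].

End Projective.

(* Main.v *)
From HB Require Import structures.
Require Import Defs.
From mathcomp Require Import all_boot all_order all_algebra.
From mathcomp Require Import reals.
From mathcomp Require Import complex.
From mathcomp Require Import mpoly.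
From mathcomp Require Import ring zify.

Set Implicit Arguments.
Unset Strict Implicit.
Unset Printing Implicit Defensive.

Import Order.TTheory GRing.Theory Num.Theory.
Local Open Scope ring_scope.

(** Choose coordinates [t0, .., t3] in which the faces of the tetrahedron are the
    coordinate planes.  The three lines [r_i] being distinct, the plane through
    the vertex 0 meets the edges of the face 0 outside the vertices, and after
    rescaling it is [l = t1 + t2 + t3 = 0] ([tetrahedron_coordinates]).  Put
    [m = t1 * t2 * t3].

    The linear system.  A sextic with the required multiplicities at the vertices is
    [t0^2 * A + t0 * B + C] with A, B, C forms in [t1, t2, t3] of degree at
    most 3 in each variable; and it is double along [r_1, r_2, r_3] iff the
    plane curves A, B, C are singular at the three points [(0, 1, -1)],
    [(1, 0, -1)], [(1, -1, 0)].  This is a small linear system for the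
    coefficients ([coef_line1] and its two analogues), with solution
    [A = l * c], [B = l * m * (linear form)] and [C = m * c'], where c and c'
    are combinations of [m] and of the three products [l * t_i * t_j]
    ([std_linsys_span]).  Conversely these forms are combinations of products of
    six linear forms, and multiplicities of products add up ([nu_form_std]).  So
    the system has dimension 11, and each of its members vanishes on the six
    edges ([nu_edge]).

    The image.  The four cubics c map the plane onto Cayley's four-nodal cubic
    surface.  The same surface is the quotient of the sextic del Pezzo surface
    by the Cremona involution, the quotient map being [x6, x0 + x2, x1 + x4,
    x3 + x5].  Matching the nodes of the two models gives a rational map [psi] from
    [P^1 x P^2] to [P^3] such that [nu o psi] is proportional to the
    quotient map of [P^1 x S_6] ([nu_psi]).  Hence a form which vanishes on the
    image of [nu] vanishes on a dense part of the quotient, and so on all of it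
    ([W_sub_nu_closure]).

    The quotient is defined as an image, without closure, so it has to be shown
    that it is closed ([nu_closure_sub]).  Enough equations of the image are
    known: quadrics, and the Cayley cubic.  A point which satisfies them has
    the coordinates [y0^2 * s], [y1^2 * s], [y0 * y1 * d], with [s] on the cubic
    surface and [d] solving [d_i * d_j = Q_ij(s)] for a matrix Q which has rank
    at most 1 on the cubic ([cayley_lift_exists]); then [s] and [d] are the sums and
    differences of coordinates of a point which satisfies the nine quadratic
    equations of the del Pezzo surface, and these cut it out ([hexagon_dp6]). *)

Local Notation "v .[[ k ]]" := (v 0 (inord k))
  (at level 2, format "v .[[ k ]]").

(** * Linear substitutions *)

(** Identities between ring morphisms or derivations need to be checked on the
    constants and the variables only. *)
Lemma mpoly_alg_ind (n : nat) (R : comNzRingType) (P : {mpoly R[n]} -> Prop) :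
  (forall c, P c%:MP) -> (forall i, P 'X_i) ->
  (forall p q, P p -> P q -> P (p + q)) ->
  (forall p q, P p -> P q -> P (p * q)) -> forall p, P p.
Proof.
move=> PC PX PD PM; elim/mpolyind => [|c m p _ _ IHp]; first by rewrite -mpolyC0.
apply/PD => //; rewrite -mul_mpolyC; apply/PM => //.
rewrite mpolyXE_id; elim/big_rec: _ => [|i q _ Pq]; first by rewrite -mpolyC1.
apply/PM => //; elim: (m i) => [|k IHk]; first by rewrite expr0 -mpolyC1.
by rewrite exprS; apply/PM.
Qed.

Lemma dhomog_bigprod (n : nat) (R : comNzRingType) (I : Type) (r : seq I)
    (d : I -> nat) (F : I -> {mpoly R[n]}) :
  (forall i, F i \is (d i).-homog) ->
  \prod_(i <- r) F i \is (\sum_(i <- r) d i)%N.-homog.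
Proof.
move=> hF; elim/big_rec2: _ => [|i e q _ hq]; first exact: dhomog1.
exact: dhomogM.
Qed.

Section LinearSubstitution.
Variable K : fieldType.

(** The transposed indexing comes from points being row vectors, on which a
    matrix acts from the right; see [meval_lin_subst]. *)
Definition lin_subst m n (A : 'M[K]_(m, n)) (F : {mpoly K[n]}) : {mpoly K[m]} :=
  F \mPo [tuple \sum_j A j i *: 'X_j | i < n].

Lemma meval_lin_subst m n (A : 'M[K]_(m, n)) (F : {mpoly K[n]}) (v : 'rV_m) :
  (lin_subst A F).@[v 0] = F.@[(v *m A) 0].
Proof.
rewrite /lin_subst comp_mpoly_meval; apply: meval_eq => i.
rewrite tnth_mktuple raddf_sum mxE; apply: eq_bigr => j _ /=.
by rewrite mevalZ mevalXU mulrC.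
Qed.

Lemma lin_substX m n (A : 'M[K]_(m, n)) i : lin_subst A 'X_i = \sum_j A j i *: 'X_j.
Proof. by rewrite /lin_subst comp_mpolyXU -tnth_nth tnth_mktuple. Qed.

Lemma lin_substD m n (A : 'M[K]_(m, n)) (F G : {mpoly K[n]}) :
  lin_subst A (F + G) = lin_subst A F + lin_subst A G.
Proof. exact: comp_mpolyD. Qed.

Lemma lin_substM m n (A : 'M[K]_(m, n)) (F G : {mpoly K[n]}) :
  lin_subst A (F * G) = lin_subst A F * lin_subst A G.
Proof. exact: rmorphM. Qed.

Lemma lin_subst_sum m n (A : 'M[K]_(m, n)) (I : Type) (r : seq I) (c : I -> K)
    (F : I -> {mpoly K[n]}) :
  lin_subst A (\sum_(i <- r) c i *: F i) =
  \sum_(i <- r) c i *: lin_subst A (F i).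
Proof.
by rewrite /lin_subst raddf_sum; apply: eq_bigr => i _; apply: comp_mpolyZ.
Qed.

Lemma lin_subst_comp m n p (A : 'M[K]_(m, n)) (B : 'M[K]_(n, p))
    (F : {mpoly K[p]}) :
  lin_subst A (lin_subst B F) = lin_subst (A *m B) F.
Proof.
elim/mpoly_alg_ind: F => [c|i|F G IHF IHG|F G IHF IHG].
- by rewrite /lin_subst !comp_mpolyC.
- rewrite !lin_substX lin_subst_sum.
  under eq_bigr do rewrite lin_substX scaler_sumr.
  rewrite exchange_big; apply: eq_bigr => j _; rewrite mxE scaler_suml.
  by apply: eq_bigr => k _; rewrite scalerA mulrC.
- by rewrite !lin_substD IHF IHG.
- by rewrite !lin_substM IHF IHG.
Qed.

Lemma lin_subst1 n (F : {mpoly K[n]}) : lin_subst 1%:M F = F.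
Proof.
elim/mpoly_alg_ind: F => [c|i|p q IHp IHq|p q IHp IHq].
- by rewrite /lin_subst comp_mpolyC.
- rewrite lin_substX (bigD1 i) //= mxE eqxx scale1r big1 ?addr0 // => j ji.
  by rewrite mxE (negbTE ji) scale0r.
- by rewrite lin_substD IHp IHq.
- by rewrite lin_substM IHp IHq.
Qed.

Lemma lin_substK n (A : 'M[K]_n) :
  A \in unitmx -> cancel (lin_subst A) (lin_subst (invmx A)).
Proof. by move=> uA F; rewrite lin_subst_comp mulVmx // lin_subst1. Qed.

Lemma lin_substVK n (A : 'M[K]_n) :
  A \in unitmx -> cancel (lin_subst (invmx A)) (lin_subst A).
Proof. by move=> uA F; rewrite lin_subst_comp mulmxV // lin_subst1. Qed.

Lemma lin_subst_homog m n (A : 'M[K]_(m, n)) (F : {mpoly K[n]}) d :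
  F \is d.-homog -> lin_subst A F \is d.-homog.
Proof.
move=> hF; rewrite (mpolyE F) lin_subst_sum big_seq.
apply: rpred_sum => e he; apply: rpredZ; rewrite /lin_subst comp_mpolyX.
have <- : (\sum_(i < n) e i)%N = d by rewrite -(dhomog_mf hF he) /= mdegE.
apply: dhomog_bigprod => i; rewrite tnth_mktuple -[X in X.-homog]mul1n.
apply: dhomogMn; apply: rpred_sum => j _; apply: rpredZ.
by rewrite dhomogX /= mdeg1.
Qed.

(** The chain rule, which makes the vanishing of all partial derivatives up to
    a given order independent of the choice of coordinates. *)
Lemma mderiv_lin_subst m n (A : 'M[K]_(m, n)) (F : {mpoly K[n]}) j :
  (lin_subst A F)^`M(j) = \sum_i A j i *: lin_subst A F^`M(i).
Proof.
elim/mpoly_alg_ind: F => [c|i|p q IHp IHq|p q IHp IHq].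
- rewrite /lin_subst comp_mpolyC mderivC big1 // => i _.
  by rewrite mderivC comp_mpoly0 scaler0.
- rewrite lin_substX raddf_sum /=.
  rewrite (bigD1 j) //= mderivZ mderivX mnmE eqxx -{1}[U_(_)%MM]add0m addmK.
  rewrite scale1r mpolyX0 big1; last first.
    by move=> k kj; rewrite mderivZ mderivX mnmE (negbTE kj) scale0r scaler0.
  rewrite (bigD1 i) //= mderivX mnmE eqxx -{1}[U_(_)%MM]add0m addmK.
  rewrite scale1r mpolyX0 big1; last first.
    move=> k ki; rewrite mderivX mnmE eq_sym (negbTE ki) scale0r.
    by rewrite /lin_subst comp_mpoly0 scaler0.
  by rewrite /lin_subst comp_mpoly1.
- rewrite lin_substD mderivD IHp IHq.
  rewrite -big_split; apply: eq_bigr => i _ /=.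
  by rewrite mderivD lin_substD scalerDr.
- rewrite lin_substM mderivM IHp IHq.
  rewrite mulr_suml mulr_sumr -big_split; apply: eq_bigr => i _ /=.
  by rewrite mderivM lin_substD !lin_substM scalerDr scalerAl scalerAr.
Qed.

End LinearSubstitution.

(** * Multiplicity at a point *)

Section Multiplicity.
Variable K : fieldType.
Implicit Types (F G : {mpoly K[4]}) (p : 'rV[K]_4).

(** This recursion on the order is what the inductions on multiplicities below
    use: first derivatives obey the Leibniz and chain rules in a simple form. *)
Lemma mult_at_pointS m F p :
  mult_at_point m.+1 F p <->
  F.@[p 0] = 0 /\ forall i, mult_at_point m F^`M(i) p.
Proof.
split=> [hF|[hF0 hF] k].
  split=> [|i k hk]; first by rewrite -[F]mderivm0m; apply: hF; rewrite mdeg0.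
  by rewrite -mderivmU1m -mderivmDm; apply: hF; rewrite mdegD mdeg1 add1n.
have [->|k0] := eqVneq k 0%MM; first by rewrite mderivm0m.
have /existsP[i ki] : [exists i, k i != 0%N].
  apply: contraR k0; rewrite negb_exists => /forallP k0.
  by apply/eqP/mnmP => i; rewrite mnm0E; apply/eqP; move: (k0 i); rewrite negbK.
have -> : k = (U_(i) + (k - U_(i)))%MM.
  rewrite addmC submK //; apply/mnm_lepP => j; rewrite mnm1E.
  by case: eqP => // <-; rewrite lt0n.
rewrite mdegD mdeg1 add1n ltnS mderivmDm mderivmU1m; exact: hF.
Qed.

Lemma mult_at_pointW m F p : mult_at_point m.+1 F p -> mult_at_point m F p.
Proof. by move=> hF k hk; apply: hF; apply: ltnW. Qed.

Lemma mult_at_point_le a b F p :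
  (a <= b)%N -> mult_at_point b F p -> mult_at_point a F p.
Proof. by move=> hab hF k hk; apply: hF; apply: leq_trans hab. Qed.

Lemma mult_at_pointD m F G p :
  mult_at_point m F p -> mult_at_point m G p -> mult_at_point m (F + G) p.
Proof. by move=> hF hG k hk; rewrite mderivmD mevalD hF // hG // addr0. Qed.

Lemma mult_at_pointZ m c F p : mult_at_point m F p -> mult_at_point m (c *: F) p.
Proof. by move=> hF k hk; rewrite mderivmZ mevalZ hF // mulr0. Qed.

Lemma mult_at_point0 m p : mult_at_point m 0 p.
Proof. by move=> k _; rewrite raddf0 meval0. Qed.

Lemma mult_at_point_sum m (I : Type) (r : seq I) (F : I -> {mpoly K[4]}) p :
  (forall i, mult_at_point m (F i) p) -> mult_at_point m (\sum_(i <- r) F i) p.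
Proof.
move=> hF; elim/big_rec: _ => [|i G _ hG]; first exact: mult_at_point0.
exact: mult_at_pointD.
Qed.

(** By the Leibniz rule a first derivative of [F * G] is a sum of two products,
    in each of which only one factor has lost one order of vanishing. *)
Lemma mult_at_pointM a b F G p :
  mult_at_point a F p -> mult_at_point b G p -> mult_at_point (a + b) (F * G) p.
Proof.
have [N] := ubnP (a + b); elim: N => // N IHN in a b F G *.
case: a => [|a]; case: b => [|b] le_N hF hG.
- by move=> k; rewrite ltn0.
- rewrite add0n; apply/mult_at_pointS; split=> [|i].
    by rewrite mevalM; case/mult_at_pointS: hG => -> _; rewrite mulr0.
  rewrite mderivM; apply: mult_at_pointD; apply: (IHN 0%N b) => //.
    exact: mult_at_pointW.
  by case/mult_at_pointS: hG.
- rewrite addn0; apply/mult_at_pointS; split=> [|i].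
    by rewrite mevalM; case/mult_at_pointS: hF => -> _; rewrite mul0r.
  rewrite -[a]addn0 mderivM; rewrite addSn ltnS in le_N.
  apply: mult_at_pointD; apply: IHN => //.
    by case/mult_at_pointS: hF.
  exact: mult_at_pointW.
- rewrite addSn; apply/mult_at_pointS; split=> [|i].
    by rewrite mevalM; case/mult_at_pointS: hF => -> _; rewrite mul0r.
  rewrite addSn ltnS in le_N; rewrite mderivM; apply: mult_at_pointD.
    by apply: IHN => //; case/mult_at_pointS: hF.
  rewrite -addSnnS; apply: IHN => //; first by rewrite addSnnS.
  by case/mult_at_pointS: hG.
Qed.

Lemma mult_lin_subst (A : 'M[K]_4) m F p :
  mult_at_point m F (p *m A) -> mult_at_point m (lin_subst A F) p.
Proof.
elim: m F => [|m IHm] F; first by move=> _ k; rewrite ltn0.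
case/mult_at_pointS => hF0 hF; apply/mult_at_pointS.
split=> [|j]; first by rewrite meval_lin_subst.
rewrite mderiv_lin_subst; apply: mult_at_point_sum => i.
by apply: mult_at_pointZ; apply: IHm.
Qed.

End Multiplicity.

(** * The eleven sextics in tetrahedral coordinates *)

Lemma forall_ord4 (P : 'I_4 -> Prop) :
  P (inord 0) -> P (inord 1) -> P (inord 2) -> P (inord 3) -> forall i, P i.
Proof.
move=> P0 P1 P2 P3 i; rewrite -(inord_val i).
by case: i => -[|[|[|[|i] ] ] ].
Qed.

Lemma big_ord4 (T : Type) (idx : T) (op : Monoid.law idx) (F : 'I_4 -> T) :
  \big[op/idx]_(i < 4) F i =
  op (F (inord 0)) (op (F (inord 1)) (op (F (inord 2)) (F (inord 3)))).
Proof.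
rewrite !big_ord_recl big_ord0 Monoid.mulm1.
by congr (op (F _) (op (F _) (op (F _) (F _)))); apply: val_inj; rewrite /= inordK.
Qed.

Lemma ord4_0 : 0 = inord 0 :> 'I_4.
Proof. by apply: val_inj; rewrite /= inordK. Qed.

Section NuForms.
Variable A : comNzRingType.
Implicit Types t : A.

(** With [c0 = m] and [c_i = - l * t_j * t_k], these are the four combinations
    [c0 + c1 + c2 + c3], [2 * (c0 + c3 - c1 - c2)], [2 * (c0 + c2 - c1 - c3)]
    and [2 * (c0 + c1 - c2 - c3)].  The [c_i] satisfy the equation
    [\sum_i \prod_(j != i) c_j = 0] of Cayley's cubic surface with its four nodes
    at the coordinate points; the sign pattern moves the nodes to where the
    invariants [x6], [x0 + x2], [x1 + x4], [x3 + x5] of the sextic del Pezzo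
    surface put them. *)
Definition cayley_seq t1 t2 t3 : seq A :=
  let l := t1 + t2 + t3 in
  let m := t1 * t2 * t3 in
  [:: m - l * (t2 * t3 + t1 * t3 + t1 * t2);
      2 * (m + l * (t2 * t3 + t1 * t3 - t1 * t2));
      2 * (m + l * (t2 * t3 + t1 * t2 - t1 * t3));
      2 * (m + l * (t1 * t3 + t1 * t2 - t2 * t3))].

(** The order of the entries and their constants are those which make
    [nu_psi] an identity with [quot_map], without a change of basis of P^10. *)
Definition nu_seq t0 t1 t2 t3 : seq A :=
  let l := t1 + t2 + t3 in
  let m := t1 * t2 * t3 in
  let s := cayley_seq t1 t2 t3 in
  [:: t0 ^+ 2 * l * s`_0; t0 ^+ 2 * l * s`_1;
      t0 ^+ 2 * l * s`_2; t0 ^+ 2 * l * s`_3;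
      - m * s`_0; - m * s`_1; - m * s`_2; - m * s`_3;
      t0 * l * m * (4 * (t1 + t2));
      - (t0 * l * m * (4 * (t1 + t3)));
      t0 * l * m * (4 * (t2 + t3))].

End NuForms.

Lemma rmorph_nu_seq (A B : comNzRingType) (f : {rmorphism A -> B}) t0 t1 t2 t3 j :
  f (nu_seq t0 t1 t2 t3)`_j = (nu_seq (f t0) (f t1) (f t2) (f t3))`_j.
Proof.
do 11?[case: j => [|j] ];
  rewrite /= ?(rmorph_nat, rmorphM, rmorphD, rmorphN, rmorph0) //.
by rewrite !nth_nil rmorph0.
Qed.

Section Forms.
Variable K : numFieldType.

Definition nu_form (j : 'I_11) : {mpoly K[4]} :=
  (nu_seq 'X_(inord 0) 'X_(inord 1) 'X_(inord 2) 'X_(inord 3))`_j.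

Definition nu (t : 'rV[K]_4) : 'rV[K]_11 :=
  \row_j (nu_seq t.[[0]] t.[[1]] t.[[2]] t.[[3]])`_j.

Lemma meval_nu_form j (t : 'rV[K]_4) : (nu_form j).@[t 0] = nu t 0 j.
Proof.
rewrite mxE -!(mevalXU (t 0)).
exact: (rmorph_nu_seq (meval (t 0)) _ _ _ _ j).
Qed.

(** The conditions of [linsysM] when the faces are the coordinate planes and
    the plane through the vertex 0 is [t1 + t2 + t3 = 0]. *)
Definition std_linsys (F : {mpoly K[4]}) : Prop :=
  [/\ F \is 6.-homog,
      forall p : 'rV[K]_4, p != 0 ->
        (forall j, j != 0 -> p 0 j = 0) -> mult_at_point 4 F p,
      forall i, i != 0 -> forall p : 'rV[K]_4, p != 0 ->
        (forall j, j != i -> p 0 j = 0) -> mult_at_point 3 F p &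
      forall i, i != 0 -> forall p : 'rV[K]_4, p != 0 ->
        p 0 i = 0 -> p.[[1]] + p.[[2]] + p.[[3]] = 0 -> mult_at_point 2 F p].

Lemma mult_at_pointN n F (p : 'rV[K]_4) :
  mult_at_point n F p -> mult_at_point n (- F) p.
Proof. by rewrite -scaleN1r; apply: mult_at_pointZ. Qed.

Lemma mult_at_pointM1 n F G (p : 'rV[K]_4) :
  mult_at_point n F p -> mult_at_point n (F * G) p.
Proof. by move=> hF; rewrite -[n]addn0; apply: mult_at_pointM. Qed.

Lemma mult_at_pointM2 n F G (p : 'rV[K]_4) :
  mult_at_point n G p -> mult_at_point n (F * G) p.
Proof. by move=> hG; rewrite -[n]add0n; apply: mult_at_pointM. Qed.

Lemma mult_at_point_root F (p : 'rV[K]_4) : F.@[p 0] = 0 -> mult_at_point 1 F p.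
Proof. by move=> Fp; apply/mult_at_pointS; split. Qed.

Local Notation X0 := ('X_(inord 0) : {mpoly K[4]}).
Local Notation X1 := ('X_(inord 1) : {mpoly K[4]}).
Local Notation X2 := ('X_(inord 2) : {mpoly K[4]}).
Local Notation X3 := ('X_(inord 3) : {mpoly K[4]}).

(** The eleven sextics are of the three shapes [t0^2 * l * s], [m * s] and
    [t0 * l * m * (linear form)], so that four multiplicities decide. *)
Lemma mult_nu_form a b c d j (p : 'rV[K]_4) :
  mult_at_point a X0 p -> mult_at_point b (X1 + X2 + X3) p ->
  mult_at_point c (X1 * X2 * X3) p ->
  (forall k, mult_at_point d (cayley_seq X1 X2 X3)`_k p) ->
  mult_at_point (minn (minn (a + a + b + d) (c + d)) (a + b + c)) (nu_form j) p.
Proof.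
move=> ha hb hc hd.
have hA k : mult_at_point (minn (minn (a + a + b + d) (c + d)) (a + b + c))
    (X0 ^+ 2 * (X1 + X2 + X3) * (cayley_seq X1 X2 X3)`_k) p.
  apply: (mult_at_point_le (b := a + a + b + d)).
    by rewrite -minnA geq_minl.
  by do 3!apply: mult_at_pointM => //.
have hB k : mult_at_point (minn (minn (a + a + b + d) (c + d)) (a + b + c))
    (- (X1 * X2 * X3) * (cayley_seq X1 X2 X3)`_k) p.
  apply: (mult_at_point_le (b := c + d)).
    by rewrite minnAC geq_minr.
  by apply: mult_at_pointM => //; apply: mult_at_pointN.
have hC G : mult_at_point (minn (minn (a + a + b + d) (c + d)) (a + b + c))
    (X0 * (X1 + X2 + X3) * (X1 * X2 * X3) * G) p.
  apply: (mult_at_point_le (b := a + b + c)); first by rewrite geq_minr.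
  by apply: mult_at_pointM1; do 2!apply: mult_at_pointM => //.
rewrite /nu_form; case: j => j /= _.
do 11?[case: j => [|j] ] => /=.
- exact: (hA 0%N).
- exact: (hA 1%N).
- exact: (hA 2%N).
- exact: (hA 3%N).
- exact: (hB 0%N).
- exact: (hB 1%N).
- exact: (hB 2%N).
- exact: (hB 3%N).
- exact: hC.
- by apply: mult_at_pointN; apply: hC.
- exact: hC.
- by rewrite nth_nil; apply: mult_at_point0.
Qed.

Lemma mult_cayley_seq d (p : 'rV[K]_4) k :
  mult_at_point d (X1 * X2 * X3) p ->
  mult_at_point d ((X1 + X2 + X3) * (X2 * X3)) p ->
  mult_at_point d ((X1 + X2 + X3) * (X1 * X3)) p ->
  mult_at_point d ((X1 + X2 + X3) * (X1 * X2)) p ->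
  mult_at_point d (cayley_seq X1 X2 X3)`_k p.
Proof.
move=> hm h1 h2 h3.
do 4?[case: k => [|k] ] => /=;
  rewrite ?nth_nil ?mulrDr ?mulrN ?mulrDr ?mulrN;
  repeat first [exact: mult_at_point0 | assumption | apply: mult_at_pointD
    | apply: mult_at_pointN | apply: mult_at_pointM2].
Qed.

Lemma homog_nu_form j : nu_form j \is 6.-homog.
Proof.
have h i : 'X_i \is [in K[4], 1.-homog] by rewrite dhomogX /= mdeg1.
have hl : X1 + X2 + X3 \is 1.-homog by do 2?apply: rpredD.
have hm : X1 * X2 * X3 \is 3.-homog.
  by apply: (dhomogM (d := 2) (e := 1)) => //; apply: (dhomogM (d := 1) (e := 1)).
have h2 a b : 'X_a * 'X_b \is [in K[4], 2.-homog].
  exact: (dhomogM (d := 1) (e := 1)).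
have h20 : X0 ^+ 2 * (X1 + X2 + X3) \is 3.-homog.
  by rewrite expr2; apply: (dhomogM (d := 2) (e := 1)).
have hs k : (cayley_seq X1 X2 X3)`_k \is 3.-homog.
  do 4?[case: k => [|k] ] => /=; rewrite ?nth_nil ?mulr_natl.
  - apply: rpredB => //; apply: (dhomogM (d := 1) (e := 2)) => //.
    by do ?apply: rpredD.
  - apply: rpredMn; apply: rpredD => //; apply: (dhomogM (d := 1) (e := 2)) => //.
    by do ?[apply: rpredB|apply: rpredD].
  - apply: rpredMn; apply: rpredD => //; apply: (dhomogM (d := 1) (e := 2)) => //.
    by do ?[apply: rpredB|apply: rpredD].
  - apply: rpredMn; apply: rpredD => //; apply: (dhomogM (d := 1) (e := 2)) => //.
    by do ?[apply: rpredB|apply: rpredD].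
  - exact: rpred0.
have hA k : X0 ^+ 2 * (X1 + X2 + X3) * (cayley_seq X1 X2 X3)`_k \is 6.-homog.
  exact: (dhomogM (d := 3) (e := 3)).
have hB k : - (X1 * X2 * X3) * (cayley_seq X1 X2 X3)`_k \is 6.-homog.
  by apply: (dhomogM (d := 3) (e := 3)) => //; apply: rpredNr.
have hC a b :
    X0 * (X1 + X2 + X3) * (X1 * X2 * X3) * (4 * ('X_a + 'X_b)) \is 6.-homog.
  apply: (dhomogM (d := 5) (e := 1)).
    by apply: (dhomogM (d := 2) (e := 3)) => //; apply: (dhomogM (d := 1) (e := 1)).
  by rewrite mulr_natl; apply: rpredMn; apply: rpredD.
rewrite /nu_form; case: j => j /= _.
do 11?[case: j => [|j] ] => /=.
- exact: (hA 0%N).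
- exact: (hA 1%N).
- exact: (hA 2%N).
- exact: (hA 3%N).
- exact: (hB 0%N).
- exact: (hB 1%N).
- exact: (hB 2%N).
- exact: (hB 3%N).
- exact: hC.
- by apply: rpredNr; apply: hC.
- exact: hC.
- by rewrite nth_nil rpred0.
Qed.

Lemma nu_form_std j : std_linsys (nu_form j).
Proof.
have I4 (a b : nat) : (a < 4)%N -> (b < 4)%N -> a != b -> inord a != inord b :> 'I_4.
  by move=> ha hb; apply: contra_neq => /(congr1 val); rewrite /= !inordK.
have mX i (p : 'rV[K]_4) : p 0 i = 0 -> mult_at_point 1 ('X_i : {mpoly K[4]}) p.
  by move=> pi; apply: mult_at_point_root; rewrite mevalXU.
have ml (p : 'rV[K]_4) : p.[[1]] + p.[[2]] + p.[[3]] = 0 ->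
    mult_at_point 1 (X1 + X2 + X3) p.
  by move=> pl; apply: mult_at_point_root; rewrite !mevalD !mevalXU.
have m0 F (p : 'rV[K]_4) : mult_at_point 0 F p by move=> k.
split.
- exact: homog_nu_form.
- move=> p _ hp.
  have p1 : p.[[1]] = 0 by apply: hp; rewrite ord4_0 I4.
  have p2 : p.[[2]] = 0 by apply: hp; rewrite ord4_0 I4.
  have p3 : p.[[3]] = 0 by apply: hp; rewrite ord4_0 I4.
  have pl := ml p; rewrite p1 p2 p3 !addr0 in pl.
  have m3 : mult_at_point 3 (X1 * X2 * X3) p.
    apply: (mult_at_pointM (a := 2) (b := 1)); last exact: mX.
    by apply: (mult_at_pointM (a := 1) (b := 1)); apply: mX.
  have m2 a b : p 0 a = 0 -> p 0 b = 0 ->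
      mult_at_point 3 ((X1 + X2 + X3) * ('X_a * 'X_b)) p.
    move=> pa pb; apply: (mult_at_pointM (a := 1) (b := 2)); first exact: pl.
    by apply: (mult_at_pointM (a := 1) (b := 1)); apply: mX.
  apply: (@mult_nu_form 0 1 3 3) => // [|k]; first exact: pl.
  by apply: mult_cayley_seq => //; apply: m2.
- move=> i i0 p _ hp.
  have m2 a b : p 0 a = 0 -> p 0 b = 0 ->
      mult_at_point 2 ('X_a * 'X_b : {mpoly K[4]}) p.
    by move=> pa pb; apply: (mult_at_pointM (a := 1) (b := 1)); apply: mX.
  have m1 a b : p 0 a = 0 \/ p 0 b = 0 ->
      mult_at_point 1 ((X1 + X2 + X3) * ('X_a * 'X_b)) p.
    case=> pab; apply: mult_at_pointM2.
      by apply: mult_at_pointM1; apply: mX.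
    by apply: mult_at_pointM2; apply: mX.
  have p0 : p.[[0]] = 0 by apply: hp; rewrite -ord4_0 eq_sym.
  have [[p12 | p13] | p23] :
      (p.[[1]] = 0 /\ p.[[2]] = 0 \/ p.[[1]] = 0 /\ p.[[3]] = 0) \/
      p.[[2]] = 0 /\ p.[[3]] = 0.
    elim/forall_ord4: i i0 hp; first by rewrite ord4_0 eqxx.
    + by right; split; apply: hp; apply: I4.
    + by left; right; split; apply: hp; apply: I4.
    + by left; left; split; apply: hp; apply: I4.
  + apply: (@mult_nu_form 1 0 2 1) => // [||k]; first exact: mX.
      by case: p12 => *; apply: mult_at_pointM1; apply: m2.
    case: p12 => *; apply: mult_cayley_seq; try by apply: m1; auto.
    by apply: (@mult_at_pointW _ 1); apply: mult_at_pointM1; apply: m2.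
  + apply: (@mult_nu_form 1 0 2 1) => // [||k]; first exact: mX.
      by case: p13 => *; rewrite mulrAC; apply: mult_at_pointM1; apply: m2.
    case: p13 => *; apply: mult_cayley_seq; try by apply: m1; auto.
    by apply: mult_at_pointM2; apply: mX.
  + apply: (@mult_nu_form 1 0 2 1) => // [||k]; first exact: mX.
      by case: p23 => *; rewrite -mulrA; apply: mult_at_pointM2; apply: m2.
    case: p23 => *; apply: mult_cayley_seq; try by apply: m1; auto.
    by apply: mult_at_pointM2; apply: mX.
- move=> i i0 p _ pi pl.
  have m3 : mult_at_point 1 (X1 * X2 * X3) p.
    elim/forall_ord4: i i0 pi; first by rewrite ord4_0 eqxx.
    + by move=> *; do 2!apply: mult_at_pointM1; apply: mX.
    + by move=> *; apply: mult_at_pointM1; apply: mult_at_pointM2; apply: mX.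
    + by move=> *; apply: mult_at_pointM2; apply: mX.
  apply: (@mult_nu_form 0 1 1 1) => // [|k]; first exact: ml.
  by apply: mult_cayley_seq => //; apply: mult_at_pointM1; apply: ml.
Qed.

End Forms.

(** * The sextics of the linear system *)

(** In affine coordinates around a vertex of the coordinate tetrahedron, the
    multiplicity of a form of degree [d] is read off from its monomials. *)
Lemma mult_at_vertex_coef (K : numFieldType) (F : {mpoly K[4]}) (d k : nat)
    (i : 'I_4) (m : 'X_{1..4}) :
  F \is d.-homog -> mult_at_point k F (delta_mx 0 i) -> (d < k + m i)%N ->
  F@_m = 0.
Proof.
move=> hF hk lt_dk.
have [/eqP md|/(dhomog_nemf_coeff hF)//] := boolP (mdeg m == d).
pose k' := (m - U_(i) *+ m i)%MM.
have k'E j : k' j = (if j == i then 0 else m j)%N.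
  rewrite mnmBE mulmnE mnm1E eq_sym.
  by case: eqP => [->|_]; rewrite ?mul1n ?subnn ?subn0.
(* Of the monomials of degree [d], only [m] contributes to the value of the
   derivative of index [k'] at the vertex. *)
have dk' : (mdeg k' + m i = d)%N.
  rewrite -md !mdegE (bigD1 i) //= [in RHS](bigD1 i) //= k'E eqxx add0n addnC.
  by congr (_ + _)%N; apply: eq_bigr => j ji; rewrite k'E (negbTE ji).
have /hk : (mdeg k' < k)%N by lia.
rewrite mderivmE raddf_sum /=.
have [min|/memN_msupp_eq0//] := boolP (m \in msupp F).
rewrite (bigD1_seq m) ?msupp_uniq //= [X in _ + X]big1_seq ?addr0; last first.
  move=> m' /andP[m'm m'in]; rewrite mevalZ mevalX.
  have [j ji m'j] : exists2 j, j != i & m' j != m j.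
    apply/exists_inP; apply: contra_neqT m'm.
    rewrite negb_exists_in => /forall_inP h.
    have hj j : j != i -> m' j = m j by move=> /h; rewrite negbK => /eqP.
    apply/mnmP => j; have [->|/hj//] := eqVneq j i.
    have := dhomog_mf hF m'in.
    rewrite -md /= !mdegE (bigD1 i) //= [in RHS](bigD1 i) //=.
    by rewrite (eq_bigr _ hj) => /addIn.
  have [lt_m|ge_m] := ltnP (m' j) (k' j).
    by rewrite (bigD1 j) //= ffact_small // mul0n mulr0 mul0r.
  rewrite [\prod_(l < 4) _ ^+ _](bigD1 j) //= mxE (negbTE ji) andbF.
  rewrite mnmBE k'E (negbTE ji) expr0n subn_eq0 leqNgt.
  suff -> : (m j < m' j)%N by rewrite mul0r mulr0.
  by rewrite ltn_neqAle eq_sym m'j; move: ge_m; rewrite k'E (negbTE ji).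
rewrite mevalZ mevalX [X in _ * X = _ -> _]big1 ?mulr1; last first.
  move=> j _; rewrite mxE eqxx /= mnmBE k'E.
  by case: eqP; rewrite ?expr1n ?subnn.
move/eqP; rewrite mulf_eq0 => /orP[/eqP//|].
rewrite pnatr_eq0 eqn0Ngt prodn_gt0 // => j; rewrite k'E.
by case: eqP => // _; rewrite ffactnn fact_gt0.
Qed.

Lemma mpoly_sum_supp (n : nat) (R : nzRingType) (F : {mpoly R[n]})
    (s : seq 'X_{1..n}) :
  uniq s -> {subset msupp F <= s} -> F = \sum_(m <- s) F@_m *: 'X_[m].
Proof.
move=> us hs; rewrite {1}(mpolyE F) [RHS](bigID (mem (msupp F))) /= -[LHS]addr0.
congr (_ + _); last first.
  by rewrite big1 // => m /memN_msupp_eq0 ->; rewrite scale0r.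
rewrite -[RHS]big_filter; apply: perm_big; apply: uniq_perm.
- exact: msupp_uniq.
- exact: filter_uniq.
by move=> m; rewrite mem_filter /= andb_idr //; apply: hs.
Qed.

Lemma quadratic_eq0 (K : numFieldType) (a b c : K) :
  (forall x, x ^+ 2 * a + x * b + c = 0) -> [/\ a = 0, b = 0 & c = 0].
Proof.
move=> h; have c0 : c = 0 by have := h 0; rewrite expr0n !mul0r !add0r.
have h1 : a + b = 0 by have := h 1; rewrite c0 expr1n !mul1r addr0.
have h2 : a - b = 0 by have := h (-1); rewrite c0 sqrrN expr1n mul1r mulN1r addr0.
have a0 : a = 0.
  have: 2 * a = (a + b) + (a - b) by ring.
  by move/eqP; rewrite h1 h2 addr0 mulf_eq0 pnatr_eq0 /= => /eqP.
by split=> //; rewrite -h1 a0 add0r.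
Qed.

Definition mon4 (e : nat * nat * nat * nat) : 'X_{1..4} :=
  let: (a, b, c, d) := e in [multinom [tuple a; b; c; d] ].

Lemma mon4E a b c d :
  (mon4 (a, b, c, d) (inord 0) = a) * (mon4 (a, b, c, d) (inord 1) = b) *
  (mon4 (a, b, c, d) (inord 2) = c) * (mon4 (a, b, c, d) (inord 3) = d).
Proof. by rewrite /mon4 !multinomE !(tnth_nth 0%N) !inordK. Qed.

Lemma mon4_surj (m : 'X_{1..4}) :
  m = mon4 (m (inord 0), m (inord 1), m (inord 2), m (inord 3)).
Proof. by apply/mnmP; apply: forall_ord4; rewrite mon4E. Qed.

Lemma mon4_inj : injective mon4.
Proof.
move=> [[[a b] c] d] [[[a' b'] c'] d'] h; have := mon4E a b c d.
by rewrite h !mon4E => -[[[-> ->] ->] ->].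
Qed.

(** The 34 monomials left by the conditions at the vertices: a quadruple point
    at the vertex 0 bounds the degree in [t0] by 2, and a triple point at each
    other vertex bounds the degree in the corresponding variable by 3. *)
Definition sextic_exps := Eval vm_compute in
  [seq e <- [seq (e, d) | e <- [seq (e, c) | e <- [seq (a, b) |
     a <- iota 0 3, b <- iota 0 4], c <- iota 0 4], d <- iota 0 4]
   | (let: (a, b, c, d) := e in a + b + c + d == 6)%N].

Lemma mem_sextic_exps a b c d : (a + b + c + d = 6)%N ->
  ((a <= 2) && (b <= 3) && (c <= 3) && (d <= 3))%N ->
  (a, b, c, d) \in sextic_exps.
Proof.
move=> h /andP[/andP[/andP[ha hb] hc] hd].
have -> : sextic_exps = [seq e <- [seq (e, d) | e <- [seq (e, c) | e <- [seq (a, b) |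
     a <- iota 0 3, b <- iota 0 4], c <- iota 0 4], d <- iota 0 4]
   | (let: (a, b, c, d) := e in a + b + c + d == 6)%N] by [].
rewrite mem_filter h eqxx andTb.
by apply: allpairs_f; [apply: allpairs_f; [apply: allpairs_f | ] | ];
  rewrite mem_iota ltnS.
Qed.

Lemma mon4_prod (R : comNzRingType) a b c d :
  'X_[mon4 (a, b, c, d)] = 'X_(inord 0) ^+ a * 'X_(inord 1) ^+ b *
     'X_(inord 2) ^+ c * 'X_(inord 3) ^+ d :> {mpoly R[4]}.
Proof. by rewrite mpolyXE_id big_ord4 /= !mon4E !mulrA. Qed.

Lemma meval_mon4 (R : comNzRingType) a b c d (v : 'I_4 -> R) :
  ('X_[mon4 (a, b, c, d)]).@[v] =
  v (inord 0) ^+ a * v (inord 1) ^+ b * v (inord 2) ^+ c * v (inord 3) ^+ d.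
Proof. by rewrite mevalX big_ord4 /= !mon4E !mulrA. Qed.

Lemma meval_lincomb (n : nat) (R : comNzRingType) (I : Type) (r : seq I)
    (c : I -> R) (G : I -> {mpoly R[n]}) v :
  (\sum_(i <- r) c i *: G i).@[v] = \sum_(i <- r) c i * (G i).@[v].
Proof. by rewrite raddf_sum; apply: eq_bigr => i _ /=; rewrite mevalZ. Qed.

Lemma mderiv_lincomb (n : nat) (R : comNzRingType) (I : Type) (r : seq I)
    (c : I -> R) (G : I -> {mpoly R[n]}) i :
  (\sum_(k <- r) c k *: G k)^`M(i) = \sum_(k <- r) c k *: (G k)^`M(i).
Proof. by rewrite raddf_sum; apply: eq_bigr => k _ /=; rewrite mderivZ. Qed.

Lemma mon4_sub a b c d :
  (mon4 (a, b, c, d) - U_(inord 1) = mon4 (a, b.-1, c, d))%MM *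
  (mon4 (a, b, c, d) - U_(inord 2) = mon4 (a, b, c.-1, d))%MM *
  (mon4 (a, b, c, d) - U_(inord 3) = mon4 (a, b, c, d.-1))%MM.
Proof.
by do !split; apply/mnmP; apply: forall_ord4;
  rewrite mnmBE mnm1E !mon4E -val_eqE /= !inordK // ?subn0 ?subn1.
Qed.

Lemma inord_neq0 k : (0 < k < 4)%N -> inord k != 0 :> 'I_4.
Proof. by case/andP=> k0 k4; rewrite -val_eqE /= inordK // -lt0n. Qed.

Section Span.
Variables (K : numFieldType) (F : {mpoly K[4]}).
Hypothesis hF : std_linsys F.

Lemma std_linsys_expand :
  F = \sum_(e <- sextic_exps) F@_(mon4 e) *: 'X_[mon4 e].
Proof.
have [hom hv0 hv _] := hF.
have nz (i : 'I_4) : delta_mx 0 i != 0 :> 'rV[K]_4.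
  by apply/eqP => /matrixP/(_ 0 i)/eqP; rewrite !mxE !eqxx oner_eq0.
have dz (i j : 'I_4) : j != i -> delta_mx 0 i 0 j = 0 :> K.
  by move=> ji; rewrite mxE (negbTE ji) andbF.
have cf i k (m : 'X_{1..4}) : mult_at_point k F (delta_mx 0 i) ->
    m \in msupp F -> (m i <= 6 - k)%N.
  move=> hk; rewrite mcoeff_msupp leqNgt; apply: contra => lt_m.
  by apply/eqP; apply: (mult_at_vertex_coef hom hk); lia.
rewrite -(big_map mon4 xpredT (fun m => F@_m *: 'X_[m])).
apply: mpoly_sum_supp; first by rewrite map_inj_uniq //; apply: mon4_inj.
move=> m hm; rewrite (mon4_surj m) map_f //.
have m0 : (m (inord 0) <= 2)%N.
  by apply: (cf _ 4) => //; apply: hv0 => // j; rewrite ord4_0; apply: dz.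
have mi i : i != 0 -> (m i <= 3)%N.
  by move=> i0; apply: (cf i 3) => //; apply: (hv i) => // j ji; apply: dz.
have ne0 k : (k < 4)%N -> k != 0%N -> inord k != 0 :> 'I_4.
  by move=> ? k0; rewrite -val_eqE /= inordK.
have := dhomog_mf hom hm; rewrite /= mdegE big_ord4 /= !addnA => hd.
by apply: mem_sextic_exps => //; rewrite m0 !mi ?ne0.
Qed.

End Span.

Lemma lincomb2_eq (K : comNzRingType) (x y k l a b : K) :
  x - y = k * a + l * b -> a = 0 -> b = 0 -> x = y.
Proof. by move=> e a0 b0; apply: subr0_eq; rewrite e a0 b0 !mulr0 addr0. Qed.

Lemma line_equations (K : comNzRingType)
    (a31 a22 a13 b32 b23 c33 a30 a21 a12 a03 b31 b22 b13 c32 c23 : K) :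
  a22 - a31 - a13 = 0 -> b32 - b23 = 0 -> - c33 = 0 ->
  2 * a22 - 3 * a31 - a13 = 0 -> 3 * b32 - 2 * b23 = 0 ->
  a30 - a21 + a12 - a03 = 0 -> - b31 + b22 - b13 = 0 -> c32 - c23 = 0 ->
  [/\ [/\ a13 = a31, a22 = 2 * a31, b32 = 0, b23 = 0 & c33 = 0],
   a21 = a12 + a30 - a03, b22 = b31 + b13 & c23 = c32].
Proof.
move=> a0 b0 c0 a2 b2 a1 b1 c1.
split; [split | | | ].
- by apply: (lincomb2_eq (k := - 2) (l := 1) _ a0 a2); ring.
- by apply: (lincomb2_eq (k := - 1) (l := 1) _ a0 a2); ring.
- by apply: (lincomb2_eq (k := - 2) (l := 1) _ b0 b2); ring.
- by apply: (lincomb2_eq (k := - 3) (l := 1) _ b0 b2); ring.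
- by apply/eqP; rewrite -oppr_eq0 c0.
- by apply: (lincomb2_eq (k := - 1) (l := 0) _ a1 a1); ring.
- by apply: (lincomb2_eq (k := 1) (l := 0) _ b1 b1); ring.
- by apply: (lincomb2_eq (k := - 1) (l := 0) _ c1 c1); ring.
Qed.

Section LineConditions.
Variables (K : numFieldType) (c : nat * nat * nat * nat -> K) (F : {mpoly K[4]}).
Hypothesis Fc : F = \sum_(e <- sextic_exps) c e *: 'X_[mon4 e].
Hypothesis mult_line : forall i, i != 0 -> forall p : 'rV[K]_4, p != 0 ->
  p 0 i = 0 -> p.[[1]] + p.[[2]] + p.[[3]] = 0 -> mult_at_point 2 F p.

Let C a b d e := c (a, b, d, e).

Lemma meval_exps v :
  F.@[v] = \sum_(e <- sextic_exps) c e * ('X_[mon4 e]).@[v].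
Proof. by rewrite Fc meval_lincomb. Qed.

Lemma meval_mderiv_exps (i : 'I_4) v : F^`M(i).@[v] =
  \sum_(e <- sextic_exps) c e * ((mon4 e i)%:R * ('X_[mon4 e - U_(i)]).@[v]).
Proof.
by rewrite Fc mderiv_lincomb meval_lincomb;
  apply: eq_bigr => e _; rewrite mderivX mevalZ.
Qed.

(** Points are given by lists of coordinates, so that evaluations at explicit
    points compute. *)
Definition singular_at (w : seq K) :=
  F.@[fun k : 'I_4 => w`_k] = 0 /\
  forall i, F^`M(i).@[fun k : 'I_4 => w`_k] = 0.

Lemma mult_on_line i (w : seq K) :
  (0 < i < 4)%N -> w`_i = 0 -> w`_1 + w`_2 + w`_3 = 0 ->
  has (fun k => w`_k != 0) (iota 0 4) -> singular_at w.
Proof.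
move=> hi wi hw /hasP[k]; rewrite mem_iota => /andP[_ k4] wk.
pose p : 'rV[K]_4 := \row_j w`_j.
have pE : p 0 =1 (fun k : 'I_4 => w`_k) by move=> j; rewrite mxE.
have /mult_at_pointS[F0 dF] : mult_at_point 2 F p.
  case/andP: (hi) => _ i4.
  apply: (mult_line (inord_neq0 hi)); rewrite ?mxE ?inordK //.
  by apply: contra_neq wk => /matrixP/(_ 0 (inord k)); rewrite !mxE inordK.
rewrite /singular_at -(meval_eq _ pE); split=> // j; rewrite -(meval_eq _ pE).
by case/mult_at_pointS: (dF j).
Qed.

Local Ltac line_ring :=
  rewrite ?meval_exps ?meval_mderiv_exps /sextic_exps !big_cons big_nil;
  rewrite ?mon4_sub ?mon4E !meval_mon4 !inordK //= /C; ring.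

(** The line [t1 = 0 = t2 + t3] consists of the points [(x, 0, 1, -1)] and of
    the vertex 0.  Write [F = t0^2 * A + t0 * B + C].  For F to be singular
    along the line, A, B and C have to be singular at [(0, 1, -1)], and this
    only constrains the coefficients of degree at most 1 in [t1].  Those of
    degree 0 make the binary forms [A (0, -)], [B (0, -)], [C (0, -)] divisible
    by [(t2 + t3)^2]; being also divisible by [t2 * t3], [t2^2 * t3^2] and
    [t2^3 * t3^3] respectively, they are a multiple of
    [t2 * t3 * (t2 + t3)^2], zero and zero.  The three other equations are the
    vanishing of the derivative with respect to [t1]. *)
Lemma coef_line1 :
  [/\ [/\ C 2 0 1 3 = C 2 0 3 1, C 2 0 2 2 = 2 * C 2 0 3 1,
      C 1 0 3 2 = 0, C 1 0 2 3 = 0 & C 0 0 3 3 = 0],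
   C 2 1 2 1 = C 2 1 1 2 + C 2 1 3 0 - C 2 1 0 3,
   C 1 1 2 2 = C 1 1 3 1 + C 1 1 1 3 & C 0 1 2 3 = C 0 1 3 2].
Proof.
have h x : singular_at [:: x; 0; 1; -1].
  apply: (@mult_on_line 1) => //=; rewrite ?oner_eq0 ?orbT //; ring.
have [a0 b0 c0] : [/\ C 2 0 2 2 - C 2 0 3 1 - C 2 0 1 3 = 0,
   C 1 0 3 2 - C 1 0 2 3 = 0 & - C 0 0 3 3 = 0].
  apply: quadratic_eq0 => x; have [<- _] := h x.
  by line_ring.
have [a2 b2 _] : [/\ 2 * C 2 0 2 2 - 3 * C 2 0 3 1 - C 2 0 1 3 = 0,
   3 * C 1 0 3 2 - 2 * C 1 0 2 3 = 0 & - 3 * C 0 0 3 3 = 0].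
  apply: quadratic_eq0 => x; have [_ /(_ (inord 2)) <-] := h x.
  by line_ring.
have [a1 b1 c1] : [/\ C 2 1 3 0 - C 2 1 2 1 + C 2 1 1 2 - C 2 1 0 3 = 0,
   - C 1 1 3 1 + C 1 1 2 2 - C 1 1 1 3 = 0 & C 0 1 3 2 - C 0 1 2 3 = 0].
  apply: quadratic_eq0 => x; have [_ /(_ (inord 1)) <-] := h x.
  by line_ring.
exact: line_equations a0 b0 c0 a2 b2 a1 b1 c1.
Qed.

Lemma coef_line2 :
  [/\ [/\ C 2 1 0 3 = C 2 3 0 1, C 2 2 0 2 = 2 * C 2 3 0 1,
      C 1 3 0 2 = 0, C 1 2 0 3 = 0 & C 0 3 0 3 = 0],
   C 2 2 1 1 = C 2 1 1 2 + C 2 3 1 0 - C 2 0 1 3,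
   C 1 2 1 2 = C 1 3 1 1 + C 1 1 1 3 & C 0 2 1 3 = C 0 3 1 2].
Proof.
have h x : singular_at [:: x; 1; 0; -1].
  apply: (@mult_on_line 2) => //=; rewrite ?oner_eq0 ?orbT //; ring.
have [a0 b0 c0] : [/\ C 2 2 0 2 - C 2 3 0 1 - C 2 1 0 3 = 0,
   C 1 3 0 2 - C 1 2 0 3 = 0 & - C 0 3 0 3 = 0].
  apply: quadratic_eq0 => x; have [<- _] := h x.
  by line_ring.
have [a2 b2 _] : [/\ 2 * C 2 2 0 2 - 3 * C 2 3 0 1 - C 2 1 0 3 = 0,
   3 * C 1 3 0 2 - 2 * C 1 2 0 3 = 0 & - 3 * C 0 3 0 3 = 0].
  apply: quadratic_eq0 => x; have [_ /(_ (inord 1)) <-] := h x.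
  by line_ring.
have [a1 b1 c1] : [/\ C 2 3 1 0 - C 2 2 1 1 + C 2 1 1 2 - C 2 0 1 3 = 0,
   - C 1 3 1 1 + C 1 2 1 2 - C 1 1 1 3 = 0 & C 0 3 1 2 - C 0 2 1 3 = 0].
  apply: quadratic_eq0 => x; have [_ /(_ (inord 2)) <-] := h x.
  by line_ring.
exact: line_equations a0 b0 c0 a2 b2 a1 b1 c1.
Qed.

Lemma coef_line3 :
  [/\ [/\ C 2 1 3 0 = C 2 3 1 0, C 2 2 2 0 = 2 * C 2 3 1 0,
      C 1 3 2 0 = 0, C 1 2 3 0 = 0 & C 0 3 3 0 = 0],
   C 2 2 1 1 = C 2 1 2 1 + C 2 3 0 1 - C 2 0 3 1,
   C 1 2 2 1 = C 1 3 1 1 + C 1 1 3 1 & C 0 2 3 1 = C 0 3 2 1].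
Proof.
have h x : singular_at [:: x; 1; -1; 0].
  apply: (@mult_on_line 3) => //=; rewrite ?oner_eq0 ?orbT //; ring.
have [a0 b0 c0] : [/\ C 2 2 2 0 - C 2 3 1 0 - C 2 1 3 0 = 0,
   C 1 3 2 0 - C 1 2 3 0 = 0 & - C 0 3 3 0 = 0].
  apply: quadratic_eq0 => x; have [<- _] := h x.
  by line_ring.
have [a2 b2 _] : [/\ 2 * C 2 2 2 0 - 3 * C 2 3 1 0 - C 2 1 3 0 = 0,
   3 * C 1 3 2 0 - 2 * C 1 2 3 0 = 0 & - 3 * C 0 3 3 0 = 0].
  apply: quadratic_eq0 => x; have [_ /(_ (inord 1)) <-] := h x.
  by line_ring.
have [a1 b1 c1] : [/\ C 2 3 0 1 - C 2 2 1 1 + C 2 1 2 1 - C 2 0 3 1 = 0,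
   - C 1 3 1 1 + C 1 2 2 1 - C 1 1 3 1 = 0 & C 0 3 2 1 - C 0 2 3 1 = 0].
  apply: quadratic_eq0 => x; have [_ /(_ (inord 3)) <-] := h x.
  by line_ring.
exact: line_equations a0 b0 c0 a2 b2 a1 b1 c1.
Qed.

End LineConditions.

Lemma big_ord11 (V : nmodType) (G : 'I_11 -> V) :
  \sum_j G j = G (inord 0) + (G (inord 1) + (G (inord 2) + (G (inord 3) +
   (G (inord 4) + (G (inord 5) + (G (inord 6) + (G (inord 7) + (G (inord 8) +
   (G (inord 9) + G (inord 10)))))))))).
Proof.
rewrite !big_ord_recl big_ord0 addr0.
by do ![congr (_ + _)]; congr G; apply: val_inj; rewrite /= inordK.
Qed.

Section Basis.
Variable K : numFieldType.

(** The shape to which the line conditions reduce a sextic, as a combination of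
    the eleven sextics.  The relations between the two sets of coefficients are
    the sign pattern of [cayley_seq], which is invertible as 2 is. *)
Lemma span_identity (w : 'I_11 -> K) (k0 k1 k2 k3 n1 n2 n3 h0 h1 h2 h3 : K) :
  k0 = w (inord 0) + 2 * (w (inord 1) + w (inord 2) + w (inord 3)) ->
  k1 = - w (inord 0) + 2 * (w (inord 1) + w (inord 2) - w (inord 3)) ->
  k2 = - w (inord 0) + 2 * (w (inord 1) - w (inord 2) + w (inord 3)) ->
  k3 = - w (inord 0) + 2 * (- w (inord 1) + w (inord 2) + w (inord 3)) ->
  h0 = - (w (inord 4) + 2 * (w (inord 5) + w (inord 6) + w (inord 7))) ->
  h1 = - (- w (inord 4) + 2 * (w (inord 5) + w (inord 6) - w (inord 7))) ->
  h2 = - (- w (inord 4) + 2 * (w (inord 5) - w (inord 6) + w (inord 7))) ->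
  h3 = - (- w (inord 4) + 2 * (- w (inord 5) + w (inord 6) + w (inord 7))) ->
  n1 = 4 * (w (inord 8) - w (inord 9)) ->
  n2 = 4 * (w (inord 8) + w (inord 10)) ->
  n3 = 4 * (w (inord 10) - w (inord 9)) ->
  let X0 : {mpoly K[4]} := 'X_(inord 0) in
  let X1 : {mpoly K[4]} := 'X_(inord 1) in
  let X2 : {mpoly K[4]} := 'X_(inord 2) in
  let X3 : {mpoly K[4]} := 'X_(inord 3) in
  let l := X1 + X2 + X3 in
  let m := X1 * X2 * X3 in
  \sum_j w j *: nu_form K j =
   X0 ^+ 2 * l * (k0%:MP * m + l * (k1%:MP * (X2 * X3) + k2%:MP * (X1 * X3) +
     k3%:MP * (X1 * X2))) +
   X0 * l * m * (n1%:MP * X1 + n2%:MP * X2 + n3%:MP * X3) +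
   m * (h0%:MP * m + l * (h1%:MP * (X2 * X3) + h2%:MP * (X1 * X3) +
     h3%:MP * (X1 * X2))).
Proof.
do 11!move->.
rewrite big_ord11 /nu_form !inordK //=.
by rewrite -!mul_mpolyC; ring.
Qed.

Lemma std_linsys_span F : std_linsys F ->
  exists w : 'rV[K]_11, F = \sum_j w 0 j *: nu_form K j.
Proof.
move=> hF; have [_ _ _ mult_line] := hF.
have [c Fc] : {c | F = \sum_(e <- sextic_exps) c e *: 'X_[mon4 e]}.
  by exists (fun e => F@_(mon4 e)); apply: std_linsys_expand.
have [[e1 e2 e3 e4 e5] e6 e7 e8] := coef_line1 Fc mult_line.
have [[f1 f2 f3 f4 f5] f6 f7 f8] := coef_line2 Fc mult_line.
have [[g1 g2 g3 g4 g5] _ g7 g8] := coef_line3 Fc mult_line.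
(* The eleven coefficients left free by the line conditions; [k0] and [h0]
   correct the coefficients of [t1 t2 t3^2 t0^2] and [t1^2 t2^2 t3^2] by what
   the other terms contribute to them. *)
pose k1 := c (2, 0, 3, 1)%N; pose k2 := c (2, 3, 0, 1)%N.
pose k3 := c (2, 3, 1, 0)%N.
pose k0 := c (2, 1, 1, 2)%N - 2 * k1 - 2 * k2 - k3.
pose n1 := c (1, 3, 1, 1)%N; pose n2 := c (1, 1, 3, 1)%N.
pose n3 := c (1, 1, 1, 3)%N.
pose h1 := c (0, 1, 3, 2)%N; pose h2 := c (0, 3, 1, 2)%N.
pose h3 := c (0, 3, 2, 1)%N.
pose h0 := c (0, 2, 2, 2)%N - h1 - h2 - h3.
pose w : 'rV[K]_11 := \row_j
  [:: (k0 - k1 - k2 - k3) / 4; (k0 + k1 + k2 - k3) / 8;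
      (k0 + k1 - k2 + k3) / 8; (k0 - k1 + k2 + k3) / 8;
      - ((h0 - h1 - h2 - h3) / 4); - ((h0 + h1 + h2 - h3) / 8);
      - ((h0 + h1 - h2 + h3) / 8); - ((h0 - h1 + h2 + h3) / 8);
      (n1 + n2 - n3) / 8; (n2 - n1 - n3) / 8; (n2 + n3 - n1) / 8]`_j.
exists w; rewrite (@span_identity (w 0) k0 k1 k2 k3 n1 n2 n3 h0 h1 h2 h3);
  rewrite ?mxE ?inordK //=; try by field.
rewrite Fc /sextic_exps !big_cons big_nil.
rewrite e6 f6 e2 e1 e3 e4 e5 e7 e8 f2 f1 f3 f4 f5 f7 f8 g2 g1 g3 g4 g5 g7 g8.
rewrite !mon4_prod -!mul_mpolyC /k0 /h0 /k1 /k2 /k3 /h1 /h2 /h3 /n1 /n2 /n3.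
by ring.
Qed.

(** The powers of [t0] separate the three groups of sextics; in each group the
    values at the sign changes of [(1, 1, 1)] form an invertible system. *)
Lemma nu_independent (w : 'rV[K]_11) :
  (forall t, \sum_j w 0 j * nu t 0 j = 0) -> w = 0.
Proof.
move=> h.
pose e k := w 0 (inord k).
have h3 (t1 t2 t3 : K) : let l := t1 + t2 + t3 in let m := t1 * t2 * t3 in
   let s := cayley_seq t1 t2 t3 in
   [/\ l * (e 0%N * s`_0 + e 1%N * s`_1 + e 2%N * s`_2 + e 3%N * s`_3) = 0,
       l * m * 4 *
         (e 8%N * (t1 + t2) - e 9%N * (t1 + t3) + e 10%N * (t2 + t3)) = 0
     & - m * (e 4%N * s`_0 + e 5%N * s`_1 + e 6%N * s`_2 + e 7%N * s`_3) = 0].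
  move=> l m s; apply: quadratic_eq0 => x.
  rewrite -[RHS](h (\row_j [:: x; t1; t2; t3]`_j)) big_ord11 !mxE !inordK //=.
  by rewrite /e /l /m /=; ring.
have cancel (a b x : K) : x = a * b -> a != 0 -> x = 0 -> b = 0.
  by move=> -> a0 /eqP; rewrite mulf_eq0 (negbTE a0) => /eqP.
have /= [a1 c1 b1] := h3 1 1 1.
have /= [a2 c2 b2] := h3 1 1 (-1).
have /= [a3 c3 b3] := h3 1 (-1) 1.
have /= [a4 c4 b4] := h3 (-1) 1 1.
have n8 : (8 : K) != 0 by rewrite pnatr_eq0.
have n8' : (-8 : K) != 0 by rewrite oppr_eq0.
have n24 : (-24 : K) != 0 by rewrite oppr_eq0 pnatr_eq0.
have e1 : e 1%N = 0 by apply: cancel n8' a2; ring.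
have e2 : e 2%N = 0 by apply: cancel n8' a3; ring.
have e3 : e 3%N = 0 by apply: cancel n8' a4; ring.
have e5 : e 5%N = 0 by apply: cancel n8' b2; ring.
have e6 : e 6%N = 0 by apply: cancel n8' b3; ring.
have e7 : e 7%N = 0 by apply: cancel n8' b4; ring.
have e8 : e 8%N = 0 by apply: cancel n8' c2; ring.
have e9 : e 9%N = 0 by apply: cancel n8 c3; ring.
have e10 : e 10%N = 0 by apply: cancel n8' c4; ring.
have e0 : e 0%N = 0 by apply: cancel n24 a1; rewrite e1 e2 e3; ring.
have e4 : e 4%N = 0 by apply: cancel n8 b1; rewrite e5 e6 e7; ring.
apply/rowP => j; rewrite mxE -(inord_val j) -/(e j).
by case: j => j hj /=; do 11!(case: j hj => [//|j] hj).
Qed.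

Lemma std_linsysD (F G : {mpoly K[4]}) :
  std_linsys F -> std_linsys G -> std_linsys (F + G).
Proof.
move=> [hF F0 F1 F2] [hG G0 G1 G2]; split=> [|p p0 hp|i i0 p p0 hp|i i0 p p0 hp pl].
- exact: rpredD.
- by apply: mult_at_pointD; [apply: F0|apply: G0].
- by apply: mult_at_pointD; [apply: (F1 i)|apply: (G1 i)].
- by apply: mult_at_pointD; [apply: (F2 i)|apply: (G2 i)].
Qed.

Lemma std_linsysZ c (F : {mpoly K[4]}) : std_linsys F -> std_linsys (c *: F).
Proof.
move=> [hF F0 F1 F2]; split=> [|p p0 hp|i i0 p p0 hp|i i0 p p0 hp pl].
- exact: rpredZ.
- by apply: mult_at_pointZ; apply: F0.
- by apply: mult_at_pointZ; apply: (F1 i).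
- by apply: mult_at_pointZ; apply: (F2 i).
Qed.

Lemma nu_form_basis : is_basis (@std_linsys K) (@nu_form K).
Proof.
split=> [w|F /std_linsys_span[w Fw] ].
  elim/big_rec: _ => [|j F _ hF]; last first.
    by apply: std_linsysD => //; apply: std_linsysZ; apply: nu_form_std.
  by rewrite -[0](scale0r (nu_form K 0)); apply: std_linsysZ; apply: nu_form_std.
exists w; split=> // w' Fw'; apply/eqP; rewrite -subr_eq0; apply/eqP.
apply: nu_independent => t.
have : (\sum_j w 0 j *: nu_form K j).@[t 0] =
       (\sum_j w' 0 j *: nu_form K j).@[t 0].
  by rewrite -Fw -Fw'.
rewrite !meval_lincomb => /eqP; rewrite -subr_eq0 -sumrB => /eqP h.
by rewrite -[RHS]h; apply: eq_bigr => j _; rewrite -meval_nu_form !mxE mulrBl.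
Qed.

Lemma nu_edge (t : 'rV[K]_4) (i j : 'I_4) k :
  i != j -> t 0 i = 0 -> t 0 j = 0 -> nu t 0 k = 0.
Proof.
move=> ij ti tj; rewrite mxE.
have [ [ [t0 [t1|[t2|t3] ] ] | [t1 t2] ] | [ [t1 t3] | [t2 t3] ] ] :
  ((t.[[0]] = 0 /\ (t.[[1]] = 0 \/ t.[[2]] = 0 \/ t.[[3]] = 0)) \/
   (t.[[1]] = 0 /\ t.[[2]] = 0)) \/
  ((t.[[1]] = 0 /\ t.[[3]] = 0) \/ (t.[[2]] = 0 /\ t.[[3]] = 0)).
  by elim/forall_ord4: i ij ti; elim/forall_ord4: j tj; rewrite ?eqxx //; tauto.
all: case: k => k /= _; do 11?[case: k => [|k] ]; rewrite /= ?nth_nil //.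
all: by rewrite ?t0 ?t1 ?t2 ?t3; ring.
Qed.

End Basis.

(** * Polynomial functions of one parameter *)

Section PolynomialFunctions.
Variable K : numFieldType.
Implicit Types g h : K -> K.

(** Density arguments are made along lines: a form is evaluated at a point
    moving with a parameter, and only the dependence on the parameter matters. *)
Definition polyfun g := exists q : {poly K}, forall s, g s = q.[s].

Lemma polyfunC c : polyfun (fun=> c).
Proof. by exists c%:P => s; rewrite hornerC. Qed.

Lemma polyfun_id : polyfun id.
Proof. by exists 'X => s; rewrite hornerX. Qed.

Lemma polyfunD g h : polyfun g -> polyfun h -> polyfun (fun s => g s + h s).
Proof. by move=> [p hp] [q hq]; exists (p + q) => s; rewrite hornerD hp hq. Qed.

Lemma polyfunN g : polyfun g -> polyfun (fun s => - g s).
Proof. by move=> [p hp]; exists (- p) => s; rewrite hornerN hp. Qed.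

Lemma polyfunM g h : polyfun g -> polyfun h -> polyfun (fun s => g s * h s).
Proof. by move=> [p hp] [q hq]; exists (p * q) => s; rewrite hornerM hp hq. Qed.

Lemma polyfunX g n : polyfun g -> polyfun (fun s => g s ^+ n).
Proof. by move=> [p hp]; exists (p ^+ n) => s; rewrite horner_exp hp. Qed.

Lemma polyfun_meval n (G : {mpoly K[n]}) (v : K -> 'rV[K]_n) :
  (forall i, polyfun (fun s => v s 0 i)) -> polyfun (fun s => G.@[v s 0]).
Proof.
move=> hv; elim/mpoly_alg_ind: G => [c|i|p q hp hq|p q hp hq].
- by have [r hr] := polyfunC c; exists r => s; rewrite mevalC.
- by have [r hr] := hv i; exists r => s; rewrite mevalXU.
- by have [r hr] := polyfunD hp hq; exists r => s; rewrite mevalD.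
- by have [r hr] := polyfunM hp hq; exists r => s; rewrite mevalM.
Qed.

Lemma polyfun_row n (l : K -> seq K) :
  (forall i, polyfun (fun s => (l s)`_i)) ->
  forall i : 'I_n, polyfun (fun s => (\row_(j < n) (l s)`_j) 0 i).
Proof. by move=> hl i; have [q hq] := hl i; exists q => s; rewrite mxE hq. Qed.

Lemma polyfun_dense g h s0 : polyfun g -> polyfun h -> h s0 != 0 ->
  (forall s, h s != 0 -> g s = 0) -> forall s, g s = 0.
Proof.
move=> [p hp] [q hq] h0 gh s.
have q0 : q != 0 by apply: contra_neq h0 => q0; rewrite hq q0 horner0.
have /eqP : p * q = 0.
  pose rs : seq K := [seq k%:R | k <- iota 0 (size (p * q)%R)].
  apply: (@roots_geq_poly_eq0 _ _ rs); last by rewrite size_map size_iota.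
    apply/allP => _ /mapP[k _ ->]; rewrite /root hornerM -hp -hq mulf_eq0.
    by have [_|/gh ->] := eqVneq (h k%:R) 0; rewrite ?eqxx ?orbT.
  by rewrite map_inj_uniq ?iota_uniq // => k l /eqP; rewrite eqr_nat => /eqP.
by rewrite mulf_eq0 (negbTE q0) orbF hp => /eqP ->; rewrite horner0.
Qed.

End PolynomialFunctions.

Local Ltac polyfun_tac :=
  repeat first [apply: polyfunC | apply: polyfun_id | apply: polyfunD
    | apply: polyfunN | apply: polyfunM | apply: polyfunX].

Lemma dhomog_meval (n : nat) (R : comNzRingType) (d : nat) (G : {mpoly R[n]}) c
    (x : 'rV[R]_n) :
  G \is d.-homog -> G.@[(c *: x) 0] = c ^+ d * G.@[x 0].
Proof.
move=> hG; rewrite !mevalE mulr_sumr !big_seq; apply: eq_bigr => m hm.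
rewrite mulrCA -(dhomog_mf hG hm) /= mdegE; congr (_ * _).
by rewrite expr_sum -big_split; apply: eq_bigr => i _; rewrite mxE exprMn.
Qed.

(** * Equations of the sextic del Pezzo surface *)

Section DelPezzo.
Variable K : numFieldType.

(** The coordinates are the lattice points of a hexagon, whose vertices are, in
    cyclic order, 0, 1, 3, 2, 4, 5, and whose centre is 6.  Each equation is an
    affine relation between lattice points: the midpoint of two opposite
    vertices is the centre, and the neighbours of a vertex have the same
    midpoint as this vertex and the centre. *)
Definition hexagon (x : 'rV[K]_7) : Prop :=
  [/\ x.[[0]] * x.[[2]] = x.[[6]] ^+ 2, x.[[1]] * x.[[4]] = x.[[6]] ^+ 2,
      x.[[3]] * x.[[5]] = x.[[6]] ^+ 2 &
  [/\ x.[[5]] * x.[[1]] = x.[[6]] * x.[[0]], x.[[0]] * x.[[3]] = x.[[6]] * x.[[1]],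
      x.[[1]] * x.[[2]] = x.[[6]] * x.[[3]] &
  [/\ x.[[3]] * x.[[4]] = x.[[6]] * x.[[2]], x.[[2]] * x.[[5]] = x.[[6]] * x.[[4]] &
      x.[[4]] * x.[[0]] = x.[[6]] * x.[[5]] ] ] ].

Lemma eq_row7 (x y : 'rV[K]_7) :
  x.[[0]] = y.[[0]] -> x.[[1]] = y.[[1]] -> x.[[2]] = y.[[2]] ->
  x.[[3]] = y.[[3]] -> x.[[4]] = y.[[4]] -> x.[[5]] = y.[[5]] ->
  x.[[6]] = y.[[6]] -> x = y.
Proof.
move=> *; apply/rowP => j; rewrite -(inord_val j).
by case: j => j hj /=; do 7!(case: j hj => [//|j] hj).
Qed.

(** As [u0 : u1 : u2 = x6 : x0 : x1] wherever these three are nonzero, the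
    inverse of the parametrization is monomial. *)
Lemma hexagon_torus x : hexagon x -> x.[[6]] != 0 ->
  x = (x.[[0]] * x.[[1]])^-1 *:
      dp6_map (\row_j [:: x.[[6]]; x.[[0]]; x.[[1]] ]`_j).
Proof.
move=> [h02 h14 h35 [h0 h1 h3 [h2 h4 h5] ] ] x6.
have x06 : x.[[6]] ^+ 2 != 0 by rewrite expf_neq0.
have x0 : x.[[0]] != 0 by apply: contra_neq x06; rewrite -h02 => ->; rewrite mul0r.
have x1 : x.[[1]] != 0 by apply: contra_neq x06; rewrite -h14 => ->; rewrite mul0r.
have x01 : x.[[0]] * x.[[1]] != 0 by rewrite mulf_neq0.
apply: (scalerI x01); rewrite scalerA divff // scale1r.
apply: eq_row7; rewrite !mxE !inordK //= ?mxE ?inordK //=.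
- ring.
- ring.
- by rewrite -h02; ring.
- by rewrite expr2 mulrA -h1; ring.
- by rewrite -h14; ring.
- by rewrite expr2 mulrA -h0; ring.
- ring.
Qed.

(** An affine chart of the toric surface is the closure of its torus [a * b != 0],
    which is in the image of [dp6_map] by [hexagon_torus].  The point [(a, b)] is
    joined to [(1, 1)] by a line. *)
Lemma chart_closure (w : K -> K -> 'rV[K]_7) (d : nat) (G : {mpoly K[7]}) :
  G \is d.-homog ->
  (forall y, proj_image (@proj_space K 3) (@dp6_map K) y -> G.@[y 0] = 0) ->
  (forall a b, hexagon (w a b)) -> (forall a b, (w a b).[[6]] = a * b) ->
  (forall a b i,
     polyfun (fun s => w (a + s * (1 - a)) (b + s * (1 - b)) 0 i)) ->
  forall a b, G.@[w a b 0] = 0.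
Proof.
move=> hG Gim hex w6 pw a b.
pose A s := a + s * (1 - a); pose B s := b + s * (1 - b).
suff /(_ 0) : forall s, G.@[w (A s) (B s) 0] = 0 by rewrite /A /B !mul0r !addr0.
apply: (@polyfun_dense _ _ (fun s => A s * B s) 1).
- by apply: polyfun_meval => i; apply: pw.
- by rewrite /A /B; polyfun_tac.
- by rewrite (_ : _ * _ = 1) ?oner_eq0 // /A /B; ring.
move=> s AB; apply: Gim.
have w0 : w (A s) (B s) != 0.
  by apply: contra_neq AB => w0; rewrite -w6 w0 mxE.
split=> //; set x := w (A s) (B s).
have x6 : x.[[6]] != 0 by rewrite /x w6.
exists (\row_j [:: x.[[6]]; x.[[0]]; x.[[1]] ]`_j), (x.[[0]] * x.[[1]])^-1.
split; last first.
  by apply: hexagon_torus => //; apply: hex.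
by apply: contra_neq x6 => /matrixP/(_ 0 (inord 0)); rewrite !mxE inordK.
Qed.

(** The hexagon equations cut out the surface: a point satisfying them has a
    nonzero vertex coordinate [v], and then lies in the chart of this vertex, in
    which all coordinates are monomials in those of the two neighbours [n]
    and [p] of [v]. *)
Lemma hexagon_dp6 x : x != 0 -> hexagon x -> dp6 x.
Proof.
move=> x0 hx; split=> // d G hG Gim.
(* The subscripts [ov], [op], [on] stand for the vertices opposite to [v], [p]
   and [n]; [l a b] lists the coordinates of the point [(a, b)] of the chart. *)
have chart (v n p ov op on : nat) (l : K -> K -> seq K) :
    perm_eq [:: v; n; p; ov; op; on; 6%N] (iota 0 7) ->
    (forall a b, [seq (l a b)`_i | i <- [:: v; n; p; ov; op; on; 6%N] ] =
       [:: 1; a; b; a ^+ 2 * b ^+ 2; a ^+ 2 * b; a * b ^+ 2; a * b]) ->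
    (forall a b, hexagon (\row_j (l a b)`_j)) ->
    (forall a b i,
       polyfun (fun s => (l (a + s * (1 - a)) (b + s * (1 - b)))`_i)) ->
    x.[[p]] * x.[[n]] = x.[[6]] * x.[[v]] ->
    x.[[v]] * x.[[ov]] = x.[[6]] ^+ 2 ->
    x.[[v]] * x.[[op]] = x.[[6]] * x.[[n]] ->
    x.[[on]] * x.[[v]] = x.[[6]] * x.[[p]] ->
    x.[[v]] != 0 -> G.@[x 0] = 0.
  move=> vnp lE hex l_poly hv hov hn hp xv.
  pose a := x.[[n]] / x.[[v]]; pose b := x.[[p]] / x.[[v]].
  suff -> : x = x.[[v]] *: (\row_j (l a b)`_j).
    rewrite (dhomog_meval _ _ hG).
    rewrite (@chart_closure (fun a b => \row_j (l a b)`_j) d) ?mulr0 //.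
      by move=> a' b'; rewrite mxE inordK //; case: (lE a' b').
    by move=> a' b'; apply: polyfun_row; apply: l_poly.
  have e6 : x.[[6]] = x.[[p]] * x.[[n]] / x.[[v]] by rewrite hv mulfK.
  have e1 : x.[[ov]] = x.[[6]] ^+ 2 / x.[[v]] by rewrite -hov mulrC mulKf.
  have e2 : x.[[op]] = x.[[6]] * x.[[n]] / x.[[v]] by rewrite -hn mulrC mulKf.
  have e3 : x.[[on]] = x.[[6]] * x.[[p]] / x.[[v]] by rewrite -hp mulfK.
  rewrite e6 in e1 e2 e3.
  apply/rowP => -[j hj]; have -> : Ordinal hj = inord j.
    by apply: val_inj; rewrite /= inordK.
  rewrite !mxE inordK //; case: (lE a b) => lv ln lp lov lop lon l6.
  have : j \in [:: v; n; p; ov; op; on; 6%N] by rewrite (perm_mem vnp) mem_iota.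
  rewrite !inE => /or4P[| | |/or4P[| | |] ] /eqP ->;
    by rewrite ?(lv, ln, lp, lov, lop, lon, l6) ?e1 ?e2 ?e3 ?e6 /a /b; field.
case: hx => [h02 h14 h35 [h0 h1 h3 [h2 h4 h5] ] ].
have [z0|] := eqVneq x.[[0]] 0; last first.
  apply: (@chart 0 1 5 2 3 4 (fun a b =>
    [:: 1; a; a ^+ 2 * b ^+ 2; a ^+ 2 * b; a * b ^+ 2; b; a * b]))
    h0 h02 h1 h5 => //.
  - by move=> a b; rewrite /hexagon !mxE !inordK //=; do ![split]; ring.
  - move=> a b i.
    by do 7?[case: i => [|i] ] => /=; rewrite ?nth_nil; polyfun_tac.
have [z1|] := eqVneq x.[[1]] 0; last first.
  apply: (@chart 1 3 0 4 2 5 (fun a b =>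
    [:: b; 1; a ^+ 2 * b; a; a ^+ 2 * b ^+ 2; a * b ^+ 2; a * b]))
    h1 h14 h3 h0 => //.
  - by move=> a b; rewrite /hexagon !mxE !inordK //=; do ![split]; ring.
  - move=> a b i.
    by do 7?[case: i => [|i] ] => /=; rewrite ?nth_nil; polyfun_tac.
have [z2|] := eqVneq x.[[2]] 0; last first.
  apply: (@chart 2 4 3 0 5 1 (fun a b =>
    [:: a ^+ 2 * b ^+ 2; a * b ^+ 2; 1; b; a; a ^+ 2 * b; a * b]))
    h2 (etrans (mulrC _ _) h02) h4 h3 => //.
  - by move=> a b; rewrite /hexagon !mxE !inordK //=; do ![split]; ring.
  - move=> a b i.
    by do 7?[case: i => [|i] ] => /=; rewrite ?nth_nil; polyfun_tac.
have [z3|] := eqVneq x.[[3]] 0; last first.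
  apply: (@chart 3 2 1 5 4 0 (fun a b =>
    [:: a * b ^+ 2; b; a; 1; a ^+ 2 * b; a ^+ 2 * b ^+ 2; a * b]))
    h3 h35 h2 h1 => //.
  - by move=> a b; rewrite /hexagon !mxE !inordK //=; do ![split]; ring.
  - move=> a b i.
    by do 7?[case: i => [|i] ] => /=; rewrite ?nth_nil; polyfun_tac.
have [z4|] := eqVneq x.[[4]] 0; last first.
  apply: (@chart 4 5 2 1 0 3 (fun a b =>
    [:: a ^+ 2 * b; a ^+ 2 * b ^+ 2; b; a * b ^+ 2; 1; a; a * b]))
    h4 (etrans (mulrC _ _) h14) h5 h2 => //.
  - by move=> a b; rewrite /hexagon !mxE !inordK //=; do ![split]; ring.
  - move=> a b i.
    by do 7?[case: i => [|i] ] => /=; rewrite ?nth_nil; polyfun_tac.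
have [z5|] := eqVneq x.[[5]] 0; last first.
  apply: (@chart 5 0 4 3 1 2 (fun a b =>
    [:: a; a ^+ 2 * b; a * b ^+ 2; a ^+ 2 * b ^+ 2; b; 1; a * b]))
    h5 (etrans (mulrC _ _) h35) h0 h4 => //.
  - by move=> a b; rewrite /hexagon !mxE !inordK //=; do ![split]; ring.
  - move=> a b i.
    by do 7?[case: i => [|i] ] => /=; rewrite ?nth_nil; polyfun_tac.
case/negP: x0; apply/eqP; apply: eq_row7; rewrite ?mxE //.
by apply/eqP; rewrite -sqrf_eq0 -h02 z0 mul0r.
Qed.

End DelPezzo.

(** * The double cover of the Cayley cubic by the del Pezzo surface *)

(** A symmetric matrix of rank at most 1 is a product [d^T * d]. *)
Lemma rank1_symmetric (K : numClosedFieldType) (q11 q22 q33 q12 q13 q23 : K) :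
  q11 * q22 = q12 ^+ 2 -> q11 * q33 = q13 ^+ 2 -> q22 * q33 = q23 ^+ 2 ->
  q11 * q23 = q12 * q13 -> q22 * q13 = q12 * q23 -> q33 * q12 = q13 * q23 ->
  exists d1 d2 d3 : K,
    [/\ d1 ^+ 2 = q11, d2 ^+ 2 = q22 & d3 ^+ 2 = q33] /\
    [/\ d1 * d2 = q12, d1 * d3 = q13 & d2 * d3 = q23].
Proof.
move=> h12 h13 h23 h1 h2 h3.
have [z1|n1] := eqVneq q11 0; last first.
  have s0 : sqrtC q11 != 0 by rewrite sqrtC_eq0.
  exists (sqrtC q11), (q12 / sqrtC q11), (q13 / sqrtC q11); split; split.
  - by rewrite sqrtCK.
  - by rewrite expr_div_n sqrtCK -h12 mulrC mulKf.
  - by rewrite expr_div_n sqrtCK -h13 mulrC mulKf.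
  - by rewrite mulrC divfK.
  - by rewrite mulrC divfK.
  - by rewrite mulrACA -h1 -invfM -expr2 sqrtCK mulrC mulKf.
have [z2|n2] := eqVneq q22 0; last first.
  have s0 : sqrtC q22 != 0 by rewrite sqrtC_eq0.
  exists (q12 / sqrtC q22), (sqrtC q22), (q23 / sqrtC q22); split; split.
  - by rewrite expr_div_n sqrtCK -h12 mulfK.
  - by rewrite sqrtCK.
  - by rewrite expr_div_n sqrtCK -h23 mulrC mulKf.
  - by rewrite divfK.
  - by rewrite mulrACA -h2 -invfM -expr2 sqrtCK mulrC mulKf.
  - by rewrite mulrC divfK.
have q12_0 : q12 = 0 by apply/eqP; rewrite -sqrf_eq0 -h12 z1 mul0r.
have q13_0 : q13 = 0 by apply/eqP; rewrite -sqrf_eq0 -h13 z1 mul0r.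
have q23_0 : q23 = 0 by apply/eqP; rewrite -sqrf_eq0 -h23 z2 mul0r.
exists 0, 0, (sqrtC q33); rewrite sqrtCK expr0n !mul0r z1 z2 q12_0 q13_0 q23_0.
by split; split.
Qed.

Section Cayley.
Variable K : numClosedFieldType.

(** The relation between the sums [s0, s1, s2, s3 = x6, x0 + x2, x1 + x4, x3 + x5]
    on the del Pezzo surface: it is a double cover of this cubic, the quotient
    by the Cremona involution. *)
Definition cayley_cubic (s0 s1 s2 s3 : K) :=
  s0 * (s1 ^+ 2 + s2 ^+ 2 + s3 ^+ 2) - 4 * s0 ^+ 3 - s1 * s2 * s3.

(** The products of the differences [d1, d2, d3 = x0 - x2, x4 - x1, x3 - x5] are
    invariant, hence expressed by the sums; the choice of a sign for [d2] makes
    these expressions symmetric in the three indices. *)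
Definition cayley_lift (s0 s1 s2 s3 d1 d2 d3 : K) : Prop :=
  [/\ d1 ^+ 2 = s1 ^+ 2 - 4 * s0 ^+ 2, d2 ^+ 2 = s2 ^+ 2 - 4 * s0 ^+ 2
    & d3 ^+ 2 = s3 ^+ 2 - 4 * s0 ^+ 2] /\
  [/\ d1 * d2 = 2 * s0 * s3 - s1 * s2, d1 * d3 = 2 * s0 * s2 - s1 * s3
    & d2 * d3 = 2 * s0 * s1 - s2 * s3].

Lemma cayley_lift_exists s0 s1 s2 s3 : cayley_cubic s0 s1 s2 s3 = 0 ->
  exists d1 d2 d3, cayley_lift s0 s1 s2 s3 d1 d2 d3.
Proof.
move=> C0.
(* The 2-minors are multiples of the cubic, by [- 4 * s0] for the principal
   ones and by [2 * s_i] for the others. *)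
have mod_C (x y k : K) : x - y = k * cayley_cubic s0 s1 s2 s3 -> x = y.
  by rewrite C0 mulr0 => /subr0_eq.
apply: rank1_symmetric;
  [apply: (mod_C _ _ (- 4 * s0))|apply: (mod_C _ _ (- 4 * s0))
  |apply: (mod_C _ _ (- 4 * s0))|apply: (mod_C _ _ (2 * s1))
  |apply: (mod_C _ _ (2 * s2))|apply: (mod_C _ _ (2 * s3))];
  by rewrite /cayley_cubic; ring.
Qed.

(** These are the anti-invariant parts of the hexagon equations.  The square of
    each left hand side is a quadratic form in [d1, d2, d3], hence a polynomial
    in the [s_i], and turns out to be a multiple of the cubic. *)
Lemma cayley_lift_linear s0 s1 s2 s3 d1 d2 d3 :
  cayley_cubic s0 s1 s2 s3 = 0 -> cayley_lift s0 s1 s2 s3 d1 d2 d3 ->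
  [/\ 2 * s0 * d1 + s2 * d3 + s3 * d2 = 0, 2 * s0 * d2 + s1 * d3 + s3 * d1 = 0
    & 2 * s0 * d3 + s1 * d2 + s2 * d1 = 0].
Proof.
move=> C0 [[d11 d22 d33] [d12 d13 d23] ].
have sq0 (x k : K) : x ^+ 2 = k * cayley_cubic s0 s1 s2 s3 -> x = 0.
  by rewrite C0 mulr0 => /eqP; rewrite sqrf_eq0 => /eqP.
split; apply: (sq0 _ (4 * s0)).
- have -> : (2 * s0 * d1 + s2 * d3 + s3 * d2) ^+ 2 =
      4 * s0 ^+ 2 * d1 ^+ 2 + s2 ^+ 2 * d3 ^+ 2 + s3 ^+ 2 * d2 ^+ 2
      + 4 * s0 * s2 * (d1 * d3) + 4 * s0 * s3 * (d1 * d2)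
      + 2 * s2 * s3 * (d2 * d3) by ring.
  by rewrite d11 d22 d33 d12 d13 d23 /cayley_cubic; ring.
- have -> : (2 * s0 * d2 + s1 * d3 + s3 * d1) ^+ 2 =
      4 * s0 ^+ 2 * d2 ^+ 2 + s1 ^+ 2 * d3 ^+ 2 + s3 ^+ 2 * d1 ^+ 2
      + 4 * s0 * s1 * (d2 * d3) + 4 * s0 * s3 * (d1 * d2)
      + 2 * s1 * s3 * (d1 * d3) by ring.
  by rewrite d11 d22 d33 d12 d13 d23 /cayley_cubic; ring.
- have -> : (2 * s0 * d3 + s1 * d2 + s2 * d1) ^+ 2 =
      4 * s0 ^+ 2 * d3 ^+ 2 + s1 ^+ 2 * d2 ^+ 2 + s2 ^+ 2 * d1 ^+ 2
      + 4 * s0 * s1 * (d2 * d3) + 4 * s0 * s2 * (d1 * d3)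
      + 2 * s1 * s2 * (d1 * d2) by ring.
  by rewrite d11 d22 d33 d12 d13 d23 /cayley_cubic; ring.
Qed.

Definition cayley_point (s0 s1 s2 s3 d1 d2 d3 : K) : 'rV[K]_7 :=
  \row_j [:: (s1 + d1) / 2; (s2 - d2) / 2; (s1 - d1) / 2; (s3 + d3) / 2;
             (s2 + d2) / 2; (s3 - d3) / 2; s0]`_j.

Lemma cayley_point_dp6 s0 s1 s2 s3 d1 d2 d3 :
  cayley_cubic s0 s1 s2 s3 = 0 -> cayley_lift s0 s1 s2 s3 d1 d2 d3 ->
  [|| s0 != 0, s1 != 0, s2 != 0 | s3 != 0] ->
  dp6 (cayley_point s0 s1 s2 s3 d1 d2 d3).
Proof.
move=> C0 hd nz; have [e1 e2 e3] := cayley_lift_linear C0 hd.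
have [[d11 d22 d33] [d12 d13 d23] ] := hd.
have n2 : (2 : K) != 0 by rewrite pnatr_eq0.
set x := cayley_point _ _ _ _ _ _ _.
have E k : (k < 7)%N -> x.[[k]] =
    [:: (s1 + d1) / 2; (s2 - d2) / 2; (s1 - d1) / 2; (s3 + d3) / 2;
        (s2 + d2) / 2; (s3 - d3) / 2; s0]`_k by move=> hk; rewrite mxE inordK.
apply: hexagon_dp6.
  apply: contraTneq nz => x0; have z k : (k < 7)%N -> x.[[k]] = 0 by rewrite x0 mxE.
  have s0_0 : s0 = 0 by have := z 6%N isT; rewrite E.
  have s1_0 : s1 = 0.
    have -> : s1 = x.[[0]] + x.[[2]] by rewrite !E //=; field.
    by rewrite !z // addr0.
  have s2_0 : s2 = 0.
    have -> : s2 = x.[[1]] + x.[[4]] by rewrite !E //=; field.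
    by rewrite !z // addr0.
  have s3_0 : s3 = 0.
    have -> : s3 = x.[[3]] + x.[[5]] by rewrite !E //=; field.
    by rewrite !z // addr0.
  by rewrite s0_0 s1_0 s2_0 s3_0 eqxx.
have sq (a b c : K) : a ^+ 2 = b ^+ 2 - 4 * c ^+ 2 ->
    (b + a) / 2 * ((b - a) / 2) = c ^+ 2.
  move=> h; rewrite (_ : _ / 2 * _ = (b ^+ 2 - a ^+ 2) / 4); last by field.
  by rewrite h; field.
have nb (a b c da db dc : K) : da * db = 2 * s0 * c - a * b ->
    2 * s0 * dc + a * db + b * da = 0 ->
    (a - da) / 2 * ((b - db) / 2) = s0 * ((c + dc) / 2).
  move=> h e; apply: subr0_eq.
  rewrite (_ : _ - _ = (da * db - (2 * s0 * c - a * b) -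
    (2 * s0 * dc + a * db + b * da)) / 4); last by field.
  by rewrite h e subrr subr0 mul0r.
have pb (a b c da db dc : K) : da * db = 2 * s0 * c - a * b ->
    2 * s0 * dc + a * db + b * da = 0 ->
    (a + da) / 2 * ((b + db) / 2) = s0 * ((c - dc) / 2).
  move=> h e; rewrite -[da]opprK -[db]opprK; apply: nb; first by rewrite mulrNN.
  by rewrite !mulrN -!opprD e oppr0.
rewrite /hexagon !E //=; split; [ | | |split; [ | | |split] ].
- exact: sq.
- by rewrite mulrC; apply: sq.
- exact: sq.
- by apply: nb; [rewrite mulrC d23 mulrC|rewrite -[RHS]e1]; ring.
- by apply: pb; [rewrite d13|rewrite -[RHS]e2]; ring.
- by apply: nb; [rewrite mulrC d12|rewrite -[RHS]e3]; ring.
- by apply: pb; [rewrite mulrC d23|rewrite -[RHS]e1]; ring.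
- by apply: nb; [rewrite d13|rewrite -[RHS]e2]; ring.
- by apply: pb; [rewrite mulrC d12|rewrite -[RHS]e3]; ring.
Qed.

End Cayley.

(** * The closure of the image lies in the quotient *)

Local Ltac quad_eval :=
  rewrite ?(mevalD, mevalB, mevalN, mevalMn, mevalM, mevalXU).

Section Closure.
Variable K : numClosedFieldType.

Lemma nu_closure_eq w (d : nat) (G : {mpoly K[11]}) :
  rat_image (@proj_space K 4) (@nu K) w -> G \is d.-homog ->
  (forall t, G.@[nu t 0] = 0) -> G.@[w 0] = 0.
Proof.
move=> [_ hw] hG Gnu; apply: (hw d) => // _ [_ [t [a [_ ->] ] ] ].
by rewrite (dhomog_meval _ _ hG) Gnu mulr0.
Qed.

(** The coordinates [w0 .. w3], [w4 .. w7], [w8 .. w10] of P^10 stand for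
    [y0^2 * s], [y1^2 * s] and [y0 * y1 * (d1, - d2, d3)].  The equations used
    are: the first two groups are proportional, both satisfy the Cayley cubic,
    and the products of two coordinates of the third group are given by the
    formulas of [cayley_lift], polarized.  They hold on the image of [nu], hence on
    its closure, and a solution of them comes from some [y], [s] and [d]. *)
Lemma nu_closure_sub w : rat_image (@proj_space K 4) (@nu K) w -> W_BS10 w.
Proof.
move=> hw.
have homX i : 'X_i \is [in K[11], 1.-homog] by rewrite dhomogX /= mdeg1.
have homXX i j : 'X_i * 'X_j \is [in K[11], 2.-homog].
  exact: (dhomogM (d := 1) (e := 1)).
have quad (i j : 'I_11) (F : {mpoly K[11]}) : F \is 2.-homog ->
    (forall t, nu t 0 i * nu t 0 j = F.@[nu t 0]) -> w 0 i * w 0 j = F.@[w 0].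
  move=> hF hFt; apply: subr0_eq.
  rewrite -(mevalXU (w 0) i) -(mevalXU (w 0) j) -mevalM -mevalB.
  apply: (nu_closure_eq hw (d := 2)); first by apply: rpredB.
  by move=> t; rewrite mevalB mevalM !mevalXU hFt subrr.
have rank1 i j : (i < 4)%N -> (j < 4)%N ->
    w.[[i]] * w.[[4 + j]] = w.[[j]] * w.[[4 + i]].
  move=> hi hj; rewrite (quad _ _ ('X_(inord j) * 'X_(inord (4 + i)))) //.
    by rewrite mevalM !mevalXU.
  move=> t; rewrite mevalM !mevalXU !mxE !inordK; try lia.
  case: i hi => [|[|[|[|//] ] ] ] _; case: j hj => [|[|[|[|//] ] ] ] _ /=; ring.
have g88 : w.[[8]] * w.[[8]] = w.[[1]] * w.[[5]] - 4 * (w.[[0]] * w.[[4]]).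
  rewrite (quad _ _ ('X_(inord 1) * 'X_(inord 5) - 'X_(inord 0) * 'X_(inord 4) *+ 4));
    first by quad_eval; ring.
    by apply: rpredB => //; apply: rpredMn.
  by move=> t; quad_eval; rewrite !mxE !inordK //=; ring.
have g99 : w.[[9]] * w.[[9]] = w.[[2]] * w.[[6]] - 4 * (w.[[0]] * w.[[4]]).
  rewrite (quad _ _ ('X_(inord 2) * 'X_(inord 6) - 'X_(inord 0) * 'X_(inord 4) *+ 4));
    first by quad_eval; ring.
    by apply: rpredB => //; apply: rpredMn.
  by move=> t; quad_eval; rewrite !mxE !inordK //=; ring.
have gaa : w.[[10]] * w.[[10]] = w.[[3]] * w.[[7]] - 4 * (w.[[0]] * w.[[4]]).
  rewrite (quad _ _ ('X_(inord 3) * 'X_(inord 7) - 'X_(inord 0) * 'X_(inord 4) *+ 4));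
    first by quad_eval; ring.
    by apply: rpredB => //; apply: rpredMn.
  by move=> t; quad_eval; rewrite !mxE !inordK //=; ring.
have g89 : w.[[8]] * w.[[9]] = w.[[1]] * w.[[6]] - 2 * (w.[[0]] * w.[[7]]).
  rewrite (quad _ _ ('X_(inord 1) * 'X_(inord 6) - 'X_(inord 0) * 'X_(inord 7) *+ 2));
    first by quad_eval; ring.
    by apply: rpredB => //; apply: rpredMn.
  by move=> t; quad_eval; rewrite !mxE !inordK //=; ring.
have g8a : w.[[8]] * w.[[10]] = 2 * (w.[[0]] * w.[[6]]) - w.[[1]] * w.[[7]].
  rewrite (quad _ _ ('X_(inord 0) * 'X_(inord 6) *+ 2 - 'X_(inord 1) * 'X_(inord 7)));
    first by quad_eval; ring.
    by apply: rpredB => //; apply: rpredMn.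
  by move=> t; quad_eval; rewrite !mxE !inordK //=; ring.
have g9a : w.[[9]] * w.[[10]] = w.[[2]] * w.[[7]] - 2 * (w.[[0]] * w.[[5]]).
  rewrite (quad _ _ ('X_(inord 2) * 'X_(inord 7) - 'X_(inord 0) * 'X_(inord 5) *+ 2));
    first by quad_eval; ring.
    by apply: rpredB => //; apply: rpredMn.
  by move=> t; quad_eval; rewrite !mxE !inordK //=; ring.
have cubic k : (k == 0) || (k == 4) ->
    cayley_cubic w.[[k]] w.[[k + 1]] w.[[k + 2]] w.[[k + 3]] = 0.
  move=> hk.
  pose n (j : nat) : 'I_11 := inord j.
  pose F : {mpoly K[11]} := 'X_(n k) * ('X_(n (k + 1)) * 'X_(n (k + 1)) +
     'X_(n (k + 2)) * 'X_(n (k + 2)) + 'X_(n (k + 3)) * 'X_(n (k + 3)))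
     - ('X_(n k) * ('X_(n k) * 'X_(n k))) *+ 4
     - 'X_(n (k + 1)) * ('X_(n (k + 2)) * 'X_(n (k + 3))).
  have FE v : F.@[v 0] = cayley_cubic v.[[k]] v.[[k + 1]] v.[[k + 2]] v.[[k + 3]].
    by rewrite /F /cayley_cubic /n; quad_eval; ring.
  rewrite -FE; apply: (nu_closure_eq hw (d := 3)).
    have homX3 i j l : 'X_i * ('X_j * 'X_l) \is [in K[11], 3.-homog].
      exact: (dhomogM (d := 1) (e := 2)).
    do 2?apply: rpredB => //; last exact: rpredMn.
    by apply: (dhomogM (d := 1) (e := 2)) => //; do ?apply: rpredD.
  move=> t; rewrite FE !mxE !inordK; try by case/orP: hk => /eqP ->.
  by rewrite /cayley_cubic; case/orP: hk => /eqP -> /=; ring.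
have w0 : w != 0 by case: hw.
have W_of_ys (y0 y1 s0 s1 s2 s3 : K) : (y0 != 0) || (y1 != 0) ->
    [|| s0 != 0, s1 != 0, s2 != 0 | s3 != 0] -> cayley_cubic s0 s1 s2 s3 = 0 ->
    [/\ w.[[0]] = y0 ^+ 2 * s0, w.[[1]] = y0 ^+ 2 * s1, w.[[2]] = y0 ^+ 2 * s2
       & w.[[3]] = y0 ^+ 2 * s3] ->
    [/\ w.[[4]] = y1 ^+ 2 * s0, w.[[5]] = y1 ^+ 2 * s1, w.[[6]] = y1 ^+ 2 * s2
       & w.[[7]] = y1 ^+ 2 * s3] -> W_BS10 w.
  move=> y_nz s_nz C0 [a0 a1 a2 a3] [b0 b1 b2 b3].
  have [d1 [d2 [d3 [hd [c1 c2 c3] ] ] ] ] : exists d1 d2 d3,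
    cayley_lift s0 s1 s2 s3 d1 d2 d3 /\
    [/\ w.[[8]] = y0 * y1 * d1, w.[[9]] = - (y0 * y1 * d2) & w.[[10]] = y0 * y1 * d3].
    rewrite a0 a1 a2 a3 b0 b1 b2 b3 in g88 g99 gaa g89 g8a g9a.
    have [y01|y01] := eqVneq (y0 * y1) 0.
      (* The third group vanishes: any lift of [s] will do. *)
      have [d1 [d2 [d3 hd] ] ] := cayley_lift_exists C0.
      exists d1, d2, d3; split=> //.
      have sq0 (x a b c d : K) : x * x = y0 ^+ 2 * a * (y1 ^+ 2 * b) -
          4 * (y0 ^+ 2 * c * (y1 ^+ 2 * d)) -> x = 0.
        move=> h; apply/eqP; rewrite -sqrf_eq0 expr2 h.
        rewrite (_ : _ - _ = (y0 * y1) ^+ 2 * (a * b - 4 * c * d)); last by ring.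
        by rewrite y01 expr0n mul0r.
      rewrite y01 !mul0r oppr0.
      by split; [apply: sq0 g88|apply: sq0 g99|apply: sq0 gaa].
    exists (w.[[8]] / (y0 * y1)), (- w.[[9]] / (y0 * y1)),
      (w.[[10]] / (y0 * y1)).
    have /norP[y0n y1n] : ~~ ((y0 == 0) || (y1 == 0)) by rewrite -mulf_eq0.
    have n01 : y0 ^+ 2 * y1 ^+ 2 != 0 by rewrite -exprMn expf_neq0.
    split; last by split; field; apply/andP.
    split; split; apply: (mulfI n01).
    - by transitivity (w.[[8]] * w.[[8]]);
        [field; apply/andP | rewrite g88; ring].
    - by transitivity (w.[[9]] * w.[[9]]);
        [field; apply/andP | rewrite g99; ring].
    - by transitivity (w.[[10]] * w.[[10]]);
        [field; apply/andP | rewrite gaa; ring].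
    - by transitivity (- (w.[[8]] * w.[[9]]));
        [field; apply/andP | rewrite g89; ring].
    - by transitivity (w.[[8]] * w.[[10]]);
        [field; apply/andP | rewrite g8a; ring].
    - by transitivity (- (w.[[9]] * w.[[10]]));
        [field; apply/andP | rewrite g9a; ring].
  split=> //.
  exists (\row_j [:: y0; y1]`_j, cayley_point s0 s1 s2 s3 d1 d2 d3), 1; split.
    split; last exact: cayley_point_dp6.
    apply: contraTneq y_nz => /= /matrixP y0E.
    have := y0E 0 (inord 0); have := y0E 0 (inord 1).
    by rewrite !mxE !inordK //= => -> ->; rewrite eqxx.
  rewrite scale1r; apply/rowP => j; rewrite -(inord_val j).
  by case: j => j hj /=; do 11!(case: j hj => [_|j hj]; first by
    rewrite ?(a0, a1, a2, a3, b0, b1, b2, b3, c1, c2, c3) /quot_map /cayley_point;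
    rewrite !mxE !inordK //= ?mxE ?inordK //=; field).
have [/hasP[k]|/hasPn a0] := boolP (has (fun k => w.[[k]] != 0) (iota 0 4)).
  rewrite mem_iota /= add0n => k4 wk.
  have b j : (j < 4)%N ->
      w.[[4 + j]] = sqrtC (w.[[4 + k]] / w.[[k]]) ^+ 2 * w.[[j]].
    by move=> j4; apply: (mulfI wk); rewrite sqrtCK (rank1 _ _ k4 j4); field.
  apply: (W_of_ys 1 _ _ _ _ _ _ _ (cubic 0%N isT)).
  - by rewrite oner_eq0.
  - by case: k k4 wk {b} => [|[|[|[|//] ] ] ] _ ->; rewrite ?orbT.
  - by rewrite expr1n !mul1r.
  - by split; [exact: (b 0%N)|exact: (b 1%N)|exact: (b 2%N)|exact: (b 3%N)].
have {}a0 k : (k < 4)%N -> w.[[k]] = 0.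
  by move=> k4; apply/eqP; rewrite -[_ == _]negbK a0 // mem_iota.
apply: (W_of_ys 0 1 _ _ _ _ _ _ (cubic 4%N isT)).
- by rewrite oner_eq0 orbT.
- apply: contraNT w0; rewrite !negb_or !negbK.
  move=> /and4P[/eqP b0 /eqP b1 /eqP b2 /eqP b3].
  have sq0 (x : K) : x * x = 0 -> x = 0 by move/eqP; rewrite mulf_eq0 orbb => /eqP.
  have c0 : w.[[8]] = 0.
    by apply: sq0; rewrite g88 (a0 1%N) // (a0 0%N) // !mul0r mulr0 subr0.
  have c1 : w.[[9]] = 0.
    by apply: sq0; rewrite g99 (a0 2%N) // (a0 0%N) // !mul0r mulr0 subr0.
  have c2 : w.[[10]] = 0.
    by apply: sq0; rewrite gaa (a0 3%N) // (a0 0%N) // !mul0r mulr0 subr0.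
  apply/eqP/rowP => j; rewrite -(inord_val j) mxE.
  by case: j => j hj /=; do 11!(case: j hj => [_|j hj]; first by
    rewrite ?(c0, c1, c2, b0, b1, b2, b3) // a0).
- by rewrite expr0n !mul0r !a0.
- by rewrite expr1n !mul1r.
Qed.

End Closure.

(** * The quotient lies in the closure of the image *)

Section Parametrization.
Variable K : numFieldType.
Implicit Types (y : 'rV[K]_2) (u : 'rV[K]_3).

Definition psum u := (u.[[0]] + u.[[1]]) * (u.[[1]] + u.[[2]]) * (u.[[2]] + u.[[0]]).
Definition pdif u := (u.[[0]] - u.[[1]]) * (u.[[1]] - u.[[2]]) * (u.[[2]] - u.[[0]]).

(** In affine terms [t_i / t0 = (y1 / y0) * e_i], where [e_1, e_2, e_3] are
    [(u1 - u2) / (u1 + u2)], [(u2 - u0) / (u2 + u0)], [(u0 - u1) / (u0 + u1)].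
    Both [y1 / y0] and the [e_i] change sign under the involution of
    [P^1 x S_6], which acts on the plane by [u_i |-> 1 / u_i].  The [e_i] come
    from equating the four nodal coordinates of the two models of the Cayley
    cubic, as [t_i] is proportional to [1 / c_i]. *)
Definition psi y u : 'rV[K]_4 :=
  \row_j [:: y.[[0]] * psum u;
             y.[[1]] *
               ((u.[[1]] - u.[[2]]) * (u.[[0]] + u.[[1]]) * (u.[[0]] + u.[[2]]));
             y.[[1]] *
               ((u.[[2]] - u.[[0]]) * (u.[[0]] + u.[[1]]) * (u.[[1]] + u.[[2]]));
             y.[[1]] *
               ((u.[[0]] - u.[[1]]) * (u.[[0]] + u.[[2]]) * (u.[[1]] + u.[[2]]))]`_j.

(** With [V = pdif u] and [P = psum u], one has [t1 + t2 + t3 = - y1 * V] and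
    [t1 * t2 * t3 = y1^3 * V * P^2] on the image of [psi]. *)
Lemma nu_psi y u :
  nu (psi y u) = - (8 * y.[[1]] ^+ 4 * pdif u ^+ 2 * psum u ^+ 3) *:
    quot_map (y, dp6_map u).
Proof.
apply/rowP => j; rewrite -(inord_val j).
by case: j => j hj /=; do 11!(case: j hj => [_|j hj]; first by
  rewrite /nu /psi /quot_map /dp6_map /psum /pdif !mxE !inordK //= ?mxE
    ?inordK //=; ring).
Qed.

Lemma psi_pdif y u :
  - ((psi y u).[[1]] + (psi y u).[[2]] + (psi y u).[[3]]) = pdif u * y.[[1]].
Proof. by rewrite !mxE !inordK //= /pdif; ring. Qed.

Lemma quot_map_psum y u :
  let z := quot_map (y, dp6_map u) in
  2 * z.[[4]] + z.[[5]] + z.[[6]] + z.[[7]] = y.[[1]] ^+ 2 * psum u.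
Proof.
by rewrite /quot_map !mxE !inordK //= ?mxE ?inordK //= /psum; ring.
Qed.

(** By [nu_psi] this holds where the factor of proportionality is nonzero; any
    [(y, u)] is joined by a line to a point with [y1 = 1] and [u = (0, 1, 2)],
    where it is nonzero. *)
Lemma quot_map_dense d (G : {mpoly K[11]}) :
  G \is d.-homog ->
  (forall z, proj_image (@proj_space K 4) (@nu K) z -> G.@[z 0] = 0) ->
  forall y u, G.@[quot_map (y, dp6_map u) 0] = 0.
Proof.
move=> hG Gim y u.
pose y' s : 'rV[K]_2 := \row_j [:: y.[[0]]; y.[[1]] + s * (1 - y.[[1]])]`_j.
pose u' s : 'rV[K]_3 := \row_j [:: u.[[0]] + s * (0 - u.[[0]]);
  u.[[1]] + s * (1 - u.[[1]]); u.[[2]] + s * (2 - u.[[2]])]`_j.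
have y'0 : y' 0 = y.
  apply/rowP => j; rewrite -(inord_val j) !mxE mul0r addr0.
  by case: j => [[|[|//] ] hj] /=; rewrite inordK.
have u'0 : u' 0 = u.
  apply/rowP => j; rewrite -(inord_val j) !mxE !mul0r !addr0.
  by case: j => [[|[|[|//] ] ] hj] /=; rewrite inordK.
pose h s := y' s 0 (inord 1) * pdif (u' s) * psum (u' s).
pose g s := G.@[quot_map (y' s, dp6_map (u' s)) 0].
suff /(_ 0) : forall s, g s = 0 by rewrite /g y'0 u'0.
have poly_y : forall i, polyfun (fun s => y' s 0 i).
  apply: polyfun_row => i.
  by do 2?[case: i => [|i] ] => /=; rewrite ?nth_nil; polyfun_tac.
have poly_u : forall i, polyfun (fun s => u' s 0 i).
  apply: polyfun_row => i.
  by do 3?[case: i => [|i] ] => /=; rewrite ?nth_nil; polyfun_tac.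
have poly_x : forall i, polyfun (fun s => dp6_map (u' s) 0 i).
  apply: polyfun_row => i.
  by do 7?[case: i => [|i] ] => /=; rewrite ?nth_nil; polyfun_tac; exact: poly_u.
apply: (@polyfun_dense _ g h 1).
- apply: polyfun_meval; apply: polyfun_row => i.
  by do 11?[case: i => [|i] ] => /=; rewrite ?nth_nil; polyfun_tac;
    first [exact: poly_y | exact: poly_x].
- by rewrite /h /pdif /psum; polyfun_tac; first [exact: poly_y | exact: poly_u].
- rewrite (_ : h 1 = 12); first by rewrite pnatr_eq0.
  by rewrite /h /pdif /psum !mxE !inordK //=; ring.
move=> s; rewrite /h /g; set Y := y' s; set U := u' s => hs.
have [y1 pd ps] : [/\ Y.[[1]] != 0, pdif U != 0 & psum U != 0].
  by move: hs; rewrite !mulf_eq0 !negb_or => /andP[/andP[-> ->] ->].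
pose c := - (8 * Y.[[1]] ^+ 4 * pdif U ^+ 2 * psum U ^+ 3).
have n8 : (8 : K) != 0 by rewrite pnatr_eq0.
have c0 : c != 0.
  rewrite oppr_eq0; apply: mulf_neq0 (expf_neq0 3 ps).
  by apply: mulf_neq0 (expf_neq0 2 pd); apply: mulf_neq0 n8 (expf_neq0 4 y1).
apply: Gim; split.
  (* [psum u] is a linear combination of the coordinates of [dp6_map u]. *)
  apply: contra_neq ps => /matrixP q0; apply: (mulfI (expf_neq0 2 y1)); rewrite mulr0.
  have e k : quot_map (Y, dp6_map U) 0 k = 0 by rewrite q0 mxE.
  by rewrite -quot_map_psum !e mulr0 !addr0.
exists (psi Y U), c^-1; rewrite nu_psi scalerA mulVf // scale1r; split=> //.
apply: contra_neq (mulf_neq0 pd y1) => /matrixP psi0.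
have e k : psi Y U 0 k = 0 by rewrite psi0 mxE.
by rewrite -psi_pdif !e !addr0 oppr0.
Qed.

(** For fixed [y] the quotient map is linear in [x], which lets the closure in
    the definition of [dp6] take over the limits in [x]. *)
Definition quot_lin y (x : 'rV[K]_7) := quot_map (y, x).

Lemma quot_lin_is_linear y : linear (quot_lin y).
Proof.
move=> a x x'; apply/rowP => i; rewrite -(inord_val i) /quot_lin /quot_map.
by case: i => i hi /=; do 11!(case: i hi => [_|i hi]; first by
  rewrite !mxE !inordK //=; ring).
Qed.

HB.instance Definition _ y :=
  GRing.isLinear.Build K 'rV[K]_7 'rV[K]_11 _ (quot_lin y) (quot_lin_is_linear y).

Lemma W_sub_nu_closure w : @W_BS10 K w -> rat_image (@proj_space K 4) (@nu K) w.
Proof.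
move=> [w0 [[y x] [a [ [y0 [x0 hx] ] wE] ] ] ]; split=> // d G hG Gim.
rewrite wE (dhomog_meval _ _ hG).
suff -> : G.@[quot_map (y, x) 0] = 0 by rewrite mulr0.
have ME z : quot_map (y, z) = z *m lin1_mx (quot_lin y) by rewrite mul_rV_lin1.
rewrite ME -meval_lin_subst; apply: (hx d); first exact: lin_subst_homog.
move=> _ [_ [u [b [_ ->] ] ] ].
rewrite (dhomog_meval _ _ (lin_subst_homog _ hG)) meval_lin_subst -ME.
by rewrite (quot_map_dense hG) ?mulr0.
Qed.

End Parametrization.

(** * Coordinates adapted to the tetrahedron and the plane *)

Lemma mulmx_neq0 (K : fieldType) n (A : 'M[K]_n) (v : 'rV[K]_n) :
  A \in unitmx -> v != 0 -> v *m A != 0.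
Proof.
by move=> uA; apply: contra_neq => vA; rewrite -[v](mulmxK uA) vA mul0mx.
Qed.

Lemma hyperplane_equation (K : fieldType) n (A : 'M[K]_n.+1) :
  \rank A = n -> exists c : 'cV[K]_n.+1, (A :=: kermx c)%MS.
Proof.
move=> rA; have rC : \rank (cokermx A) = 1%N by rewrite mxrank_coker rA subSnn.
have [j cj] : exists j, col j (cokermx A) != 0.
  apply/existsP; apply: contraPT rC => /existsPn C0.
  suff -> : cokermx A = 0 by rewrite mxrank0.
  apply/matrixP => i j; have /eqP/matrixP/(_ i 0) := negbNE (C0 j).
  by rewrite !mxE.
exists (col j (cokermx A)); set c := col _ _ in cj *.
have Ac : (A <= kermx c)%MS.
  by apply/sub_kermxP; rewrite /c colE mulmxA mulmx_coker mul0mx.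
apply/eqmxP; rewrite Ac -(geq_leqif (mxrank_leqif_sup Ac)) rA mxrank_ker.
have := rank_leq_col c; rewrite leq_eqVlt ltnS leqn0 mxrank_eq0 (negbTE cj) orbF.
by move=> /eqP ->; rewrite subSS subn0 leqnn.
Qed.

(** Take equations of the faces as coordinates.  As the plane passes through the
    vertex 0, its equation is [a1 * t1 + a2 * t2 + a3 * t3 = 0]; if some [a_i]
    was zero, then either the lines in the two other faces would coincide,
    or the plane would be one of these faces.  So the coordinates can be rescaled
    to have all [a_i] equal to 1. *)
Lemma tetrahedron_coordinates (K : fieldType) (f : 'I_4 -> 'M[K]_4)
    (pi : 'M[K]_4) (r : 'I_4 -> 'M[K]_4) :
  is_tetrahedron f -> \rank pi = 3%N -> (vertex f 0 <= pi)%MS ->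
  (forall i, i != 0 -> (r i :=: f i :&: pi)%MS) ->
  (forall i, i != 0 -> \rank (r i) = 2%N) ->
  (forall i j, i != 0 -> j != 0 -> i != j -> ~~ (r i == r j)%MS) ->
  exists2 N : 'M[K]_4, N \in unitmx &
    (forall i (p : 'rV_4), (p <= f i)%MS = ((p *m N) 0 i == 0)) /\
    (forall p : 'rV_4, (p <= pi)%MS =
       ((p *m N).[[1]] + (p *m N).[[2]] + (p *m N).[[3]] == 0)).
Proof.
move=> [rf If] rpi v0pi hr r2 rdist.
have [c hc] : exists c : 'I_4 -> 'cV[K]_4, forall i, (f i :=: kermx (c i))%MS.
  exact: fin_all_exists (fun i => hyperplane_equation (rf i)).
have [e he] := hyperplane_equation rpi.
pose N0 : 'M[K]_4 := \matrix_(i, j) c j i 0.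
have cE (d : 'cV[K]_4) (p : 'rV[K]_4) : (p <= kermx d)%MS = ((p *m d) 0 0 == 0).
  apply/sub_kermxP/eqP => [->|h]; first by rewrite mxE.
  by apply/rowP => j; rewrite ord1 h mxE.
have fE i (p : 'rV_4) : (p <= f i)%MS = ((p *m N0) 0 i == 0).
  rewrite hc cE !mxE; congr (_ == 0).
  by apply: eq_bigr => j _; rewrite !mxE.
have uN0 : N0 \in unitmx.
  rewrite -row_free_unit -kermx_eq0 -submx0.
  have /eqP <- : (\bigcap_i f i)%MS == 0 by rewrite -mxrank_eq0 If.
  apply/sub_bigcapmxP => i _; apply/row_subP => j.
  by rewrite fE -row_mul mulmx_ker mxE mxE.
pose a := invmx N0 *m e.
have eE : e = N0 *m a by rewrite mulKVmx.
have piE (p : 'rV_4) : (p <= pi)%MS = (\sum_i (p *m N0) 0 i * a i 0 == 0).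
  by rewrite he cE eE mulmxA mxE.
have a0 : a 0 0 = 0.
  pose p := delta_mx 0 0 *m invmx N0 : 'rV[K]_4.
  have pN : p *m N0 = delta_mx 0 0 by rewrite mulmxKV.
  have /(submx_trans) /(_ v0pi) : (p <= vertex f 0)%MS.
    by apply/sub_bigcapmxP => j j0; rewrite fE pN mxE (negbTE j0) andbF.
  rewrite piE pN (bigD1 0) //= mxE eqxx mul1r big1 ?addr0 => [/eqP//|j j0].
  by rewrite mxE (negbTE j0) andbF mul0r.
have {}piE (p : 'rV_4) : (p <= pi)%MS = ((p *m N0).[[1]] * a (inord 1) 0 +
    (p *m N0).[[2]] * a (inord 2) 0 + (p *m N0).[[3]] * a (inord 3) 0 == 0).
  by rewrite piE big_ord4 /= -ord4_0 a0 mulr0 add0r addrA.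
have face_sub k : k != 0 -> ~~ (f k <= pi)%MS.
  move=> k0; apply: contra_eqN (r2 k k0) => fk_pi.
  by rewrite (hr k k0) (capmx_idPl fk_pi) rf.
have a_neq0 i j k : j != 0 -> k != 0 -> j != k ->
    (forall p : 'rV_4, (p <= pi)%MS = ((p *m N0) 0 i * a i 0 +
       (p *m N0) 0 j * a j 0 + (p *m N0) 0 k * a k 0 == 0)) -> a i 0 != 0.
  move=> j0 k0 jk hpi; apply/negP => /eqP ai.
  have aj : a j 0 != 0.
    apply: contra (face_sub k k0) => /eqP aj; apply/rV_subP => p.
    by rewrite fE hpi ai aj !mulr0 !add0r => /eqP ->; rewrite mul0r.
  have ak : a k 0 != 0.
    apply: contra (face_sub j j0) => /eqP ak; apply/rV_subP => p.
    by rewrite fE hpi ai ak !mulr0 add0r addr0 => /eqP ->; rewrite mul0r.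
  have rE (p : 'rV_4) : (p <= r j)%MS = (p <= r k)%MS.
    rewrite !hr // !sub_capmx !fE hpi ai mulr0 add0r.
    have [->|tj] := eqVneq ((p *m N0) 0 j) 0;
      have [->|tk] := eqVneq ((p *m N0) 0 k) 0 => //=.
      by rewrite mul0r add0r mulf_eq0 (negbTE tk) (negbTE ak).
    by rewrite mul0r addr0 mulf_eq0 (negbTE tj) (negbTE aj).
  by case/negP: (rdist _ _ j0 k0 jk); apply/andP; split; apply/rV_subP => p; rewrite rE.
have I4 x y : (0 < x < 4)%N -> (0 < y < 4)%N -> x != y -> inord x != inord y :> 'I_4.
  by move=> /andP[_ hx] /andP[_ hy]; rewrite -val_eqE /= !inordK.
have n1 := @inord_neq0 1 isT; have n2 := @inord_neq0 2 isT.
have n3 := @inord_neq0 3 isT.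
have a1 : a (inord 1) 0 != 0.
  by apply: (a_neq0 _ (inord 2) (inord 3)) => //; exact: I4.
have a2 : a (inord 2) 0 != 0.
  apply: (a_neq0 _ (inord 1) (inord 3)) => //; first exact: I4.
  by move=> p; rewrite piE; congr (_ == 0); ring.
have a3 : a (inord 3) 0 != 0.
  apply: (a_neq0 _ (inord 1) (inord 2)) => //; first exact: I4.
  by move=> p; rewrite piE; congr (_ == 0); ring.
pose D : 'rV[K]_4 := \row_i (if i == 0 then 1 else a i 0).
have D0 i : D 0 i != 0.
  elim/forall_ord4: i; rewrite mxE; first by rewrite -ord4_0 /= oner_eq0.
  - by rewrite (negbTE n1).
  - by rewrite (negbTE n2).
  - by rewrite (negbTE n3).
have NE (p : 'rV_4) i : (p *m (N0 *m diag_mx D)) 0 i = (p *m N0) 0 i * D 0 i.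
  rewrite mulmxA mxE (bigD1 i) //= [diag_mx _ _ _]mxE eqxx mulr1n.
  rewrite big1 ?addr0 // => j ji.
  by rewrite [diag_mx _ _ _]mxE (negbTE ji) mulr0n mulr0.
exists (N0 *m diag_mx D).
  rewrite unitmx_mul uN0 unitmxE det_diag unitfE /=.
  by apply/prodf_neq0 => i _.
split=> [i p|p]; rewrite ?NE; first by rewrite fE mulf_eq0 (negbTE (D0 i)) orbF.
by rewrite piE ![D 0 _]mxE (negbTE n1) (negbTE n2) (negbTE n3).
Qed.

Lemma zclosure_mulmx (K : fieldType) n (Y Z : 'rV[K]_n -> Prop) (A : 'M[K]_n) w :
  A \in unitmx -> (forall y, Y y -> Z (y *m A)) ->
  zclosure Y w -> zclosure Z (w *m A).
Proof.
move=> uA YZ [w0 hw]; split.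
  by apply: contra_neq w0 => wA; rewrite -[w](mulmxK uA) wA mul0mx.
move=> d G hG GZ; rewrite -meval_lin_subst.
apply: (hw d); first exact: lin_subst_homog.
by move=> y /YZ/GZ; rewrite meval_lin_subst.
Qed.

Section Coordinates.
Variable K : numClosedFieldType.
Variables (f r : 'I_4 -> 'M[K]_4) (pi N : 'M[K]_4).
Hypothesis uN : N \in unitmx.
Hypothesis fE : forall i (p : 'rV_4), (p <= f i)%MS = ((p *m N) 0 i == 0).
Hypothesis piE : forall p : 'rV_4, (p <= pi)%MS =
  ((p *m N).[[1]] + (p *m N).[[2]] + (p *m N).[[3]] == 0).
Hypothesis hr : forall i, i != 0 -> (r i :=: f i :&: pi)%MS.

Let vertexP i (p : 'rV_4) :
  reflect (forall j, j != i -> (p *m N) 0 j = 0) (p <= vertex f i)%MS.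
Proof.
apply: (iffP sub_bigcapmxP) => h j ji; first by apply/eqP; rewrite -fE h.
by rewrite fE h.
Qed.

Let uVN : invmx N \in unitmx. Proof. by rewrite unitmx_inv. Qed.

Let rE i (p : 'rV_4) : i != 0 -> (p <= r i)%MS =
  ((p *m N) 0 i == 0) && ((p *m N).[[1]] + (p *m N).[[2]] + (p *m N).[[3]] == 0).
Proof. by move=> i0; rewrite hr // sub_capmx fE piE. Qed.

Lemma linsysM_std F : linsysM f r F <-> std_linsys (lin_subst (invmx N) F).
Proof.
split=> [[hF F0 F1 F2]|[hF F0 F1 F2] ].
  split; first exact: lin_subst_homog.
  - move=> t t0 ht; apply: mult_lin_subst; apply: F0 (mulmx_neq0 uVN t0) _.
    by apply/vertexP; rewrite mulmxKV.
  - move=> i i0 t t0 ht; apply: mult_lin_subst.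
    apply: (F1 i) (mulmx_neq0 uVN t0) _ => //.
    by apply/vertexP; rewrite mulmxKV.
  - move=> i i0 t t0 ti tl; apply: mult_lin_subst.
    apply: (F2 i) (mulmx_neq0 uVN t0) _ => //.
    by rewrite rE // mulmxKV // ti tl eqxx.
rewrite -[F](lin_substVK uN); split; first exact: lin_subst_homog.
- by move=> p p0 /vertexP hp; apply: mult_lin_subst; apply: F0 (mulmx_neq0 uN p0) hp.
- move=> i i0 p p0 /vertexP hp; apply: mult_lin_subst.
  exact: (F1 i) (mulmx_neq0 uN p0) hp.
- move=> i i0 p p0; rewrite rE // => /andP[/eqP hp /eqP hl]; apply: mult_lin_subst.
  exact: (F2 i) (mulmx_neq0 uN p0) hp hl.
Qed.

Definition adapted_basis (j : 'I_11) : {mpoly K[4]} := lin_subst N (nu_form K j).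

Lemma adapted_basisP : is_basis (linsysM f r) adapted_basis.
Proof.
have [std_comb std_dec] := nu_form_basis K.
split=> [c|F /linsysM_std/std_dec[c [Fc c_uniq] ] ].
  by apply/linsysM_std; rewrite -lin_subst_sum lin_substK.
exists c; split=> [|c' Fc']; first by rewrite -lin_subst_sum -Fc lin_substVK.
by apply: c_uniq; rewrite Fc' -lin_subst_sum lin_substK.
Qed.

Lemma linsysM_contains_edges F (i j : 'I_4) : linsysM f r F -> (i < j)%N ->
  contains F (edge f i j).
Proof.
move=> hF ij p; rewrite sub_capmx !fE => /andP[/eqP pi0 /eqP pj0].
have [c [-> _] ] := adapted_basisP.2 _ hF.
rewrite meval_lincomb big1 // => k _; rewrite meval_lin_subst meval_nu_form.
rewrite (nu_edge _ _ pi0 pj0) ?mulr0 //.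
by apply: contraTneq ij => ->; rewrite ltnn.
Qed.

Lemma linsys_map_adapted p : linsys_map adapted_basis p = nu (p *m N).
Proof.
by apply/rowP => j; rewrite mxE meval_lin_subst meval_nu_form.
Qed.

(** The inverse of the change of basis is the change of basis in the other
    direction, by uniqueness of coordinates. *)
Lemma base_change (b : 'I_11 -> {mpoly K[4]}) : is_basis (linsysM f r) b ->
  exists2 C : 'M[K]_11, C \in unitmx &
    forall p, linsys_map b p = nu (p *m N) *m C.
Proof.
move=> [b_comb b_dec]; have [a_comb a_dec] := adapted_basisP.
have delta_sum (e : 'I_11 -> {mpoly K[4]}) j :
    e j = \sum_k (delta_mx 0 j : 'rV[K]_11) 0 k *: e k.
  rewrite (bigD1 j) //= mxE !eqxx scale1r big1 ?addr0 // => k kj.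
  by rewrite mxE (negbTE kj) andbF scale0r.
have bM j : linsysM f r (b j) by rewrite delta_sum.
have aM j : linsysM f r (adapted_basis j) by rewrite delta_sum.
have /fin_all_exists[C hC] j : exists c : 'rV[K]_11,
    b j = \sum_k c 0 k *: adapted_basis k.
  by have [c [bc _] ] := a_dec _ (bM j); exists c.
have /fin_all_exists[D hD] j : exists c : 'rV[K]_11,
    adapted_basis j = \sum_k c 0 k *: b k.
  by have [c [bc _] ] := b_dec _ (aM j); exists c.
pose CM : 'M[K]_11 := \matrix_(j, k) C j 0 k.
pose DM : 'M[K]_11 := \matrix_(j, k) D j 0 k.
have DC : DM *m CM = 1%:M.
  apply/row_matrixP => j; rewrite row1.
  have [c [_ c_uniq] ] := a_dec _ (aM j).
  rewrite -(c_uniq _ (delta_sum _ j)); apply/esym/c_uniq.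
  rewrite [LHS]hD; under eq_bigr do rewrite hC scaler_sumr.
  rewrite exchange_big; apply: eq_bigr => k _; rewrite !mxE scaler_suml.
  by apply: eq_bigr => l _; rewrite !mxE scalerA.
exists CM^T; first by rewrite unitmx_tr; case: (mulmx1_unit DC).
move=> p; apply/rowP => j; rewrite -linsys_map_adapted !mxE hC meval_lincomb.
by apply: eq_bigr => k _; rewrite !mxE mulrC.
Qed.

Lemma rat_image_linsys (b : 'I_11 -> {mpoly K[4]}) : is_basis (linsysM f r) b ->
  proj_equiv (rat_image (@proj_space K 4) (linsys_map b)) (@W_BS10 K).
Proof.
move=> /base_change[C uC bE]; exists (invmx C); first by rewrite unitmx_inv.
have WE w : W_BS10 w <-> rat_image (@proj_space K 4) (@nu K) w.
  by split; [exact: W_sub_nu_closure|exact: nu_closure_sub].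
move=> w; rewrite WE; split.
  apply: zclosure_mulmx; first by rewrite unitmx_inv.
  move=> y [y0 [p [a [p0 yE] ] ] ]; split; first by rewrite mulmx_neq0 ?unitmx_inv.
  rewrite yE.
  exists (p *m N), a; split; first exact: (mulmx_neq0 uN).
  by rewrite bE -scalemxAl mulmxK.
rewrite -{2}[w](mulmxKV uC); apply: zclosure_mulmx => // y [y0 [t [a [t0 yE] ] ] ].
split; first exact: mulmx_neq0.
rewrite yE.
exists (t *m invmx N), a; split; first exact: (mulmx_neq0 uVN).
by rewrite bE mulmxKV // scalemxAl.
Qed.

End Coordinates.

Theorem theorem7p1 (R : realType)
    (f : 'I_4 -> 'M[R[i]]_4) (hT : is_tetrahedron f)
    (pi : 'M[R[i]]_4) (hpi : \rank pi = 3%N)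
    (hv0 : (vertex f 0 <= pi)%MS)
    (r : 'I_4 -> 'M[R[i]]_4)
    (hr : forall i : 'I_4, i != 0 -> (r i :=: f i :&: pi)%MS)
    (hline : forall i : 'I_4, i != 0 -> \rank (r i) = 2%N)
    (hdistinct : forall i j : 'I_4, i != 0 -> j != 0 -> i != j ->
       ~~ (r i == r j)%MS)
    (q : 'I_4 -> 'M[R[i]]_4)
    (hq : forall i : 'I_4, i != 0 -> (q i :=: r i :&: edge f 0 i)%MS) :
  (exists b : 'I_11 -> {mpoly R[i][4]}, is_basis (linsysM f r) b) /\
  (forall b : 'I_11 -> {mpoly R[i][4]}, is_basis (linsysM f r) b ->
     proj_equiv (rat_image (@proj_space R[i] 4) (linsys_map b)) (@W_BS10 R[i])
     /\ generically (fun c : 'rV[R[i]]_11 =>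
          forall i j : 'I_4, (i < j)%N ->
            contains (\sum_k c 0 k *: b k) (edge f i j))).
Proof.
have [N uN [fE piE] ] := tetrahedron_coordinates hT hpi hv0 hr hline hdistinct.
split=> [|b hb]; first by exists (adapted_basis N); apply: adapted_basisP uN fE piE hr.
split; first exact (rat_image_linsys (K := R[i]) uN fE piE hr hb).
exists 1 => [|c _ i j ij]; first exact: oner_neq0.
exact (linsysM_contains_edges (K := R[i]) uN fE piE hr (hb.1 c) ij).
Qed.
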